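(* Let $1\le d\le n$ be integers, let $\{\mathbf U_t\}_{t\in\mathbb N}$ be a sequence in $\operatorname{Gr}(n,d)$ and $\{u_t\}_{t\in\mathbb N}$ a sequence in $\mathbb R^n$. Let $t_0\ge d$ be an integer, $\hat{\mathbf U}_{t_0}\in\operatorname{Gr}(n,d)$, and let $T\in\{d,\dots,t_0+1\}$, $K\ge 1$ be integers. Assume: (A1) there is $\epsilon\ge 0$ such that for every $t\in\mathbb N$, $u_t=\bar u_t+e_t$ with $\bar u_t\in\mathbf U_t$ and $\|e_t\|_2\le\epsilon$; (A2) there is $c\ge 0$ such that $d_2(\mathbf U_t,\mathbf U_{t+1})\le c$ for all $t\in\mathbb N$; (A3) there are constants $0<\underline\sigma\le\overline\sigma$ such that, with $W_t=[u_{t-T+1}\ u_{t-T+2}\ \dots\ u_t]\in\mathbb R^{n\times T}$, $\sigma_1(P_{\mathbf U_t}W_t)\le\overline\sigma$ and $\sigma_d(P_{\mathbf U_t}W_t)\ge\underline\sigma$ for all integers $t\ge T$. Let $0<\alpha<\dfrac{\underline\sigma^2}{2\overline\sigma^4}$ and assume further: (A4) $\hat{\mathbf U}_{t_0}\in\mathbb B_{r_{\mathrm b}}(\mathbf U_{t_0+1})$ for some $r_{\mathrm b}$ with $c\le r_{\mathrm b}<1$, and, with $\tilde\rho:=1-4(1-r_{\mathrm b}^2)(\alpha\underline\sigma^2-2\alpha^2\overline\sigma^4)\ge 0$, $$\gamma_{r_{\mathrm b}}(\delta_t)\le(1-\tilde\rho)r_{\mathrm b}^2+\frac{(1-\tilde\rho)(c^2-2cr_{\mathrm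 b})}{1-\tilde\rho^K}$$ for all integers $t\ge t_0$ with $t\ge T$. Suppose moreover that $c=0$ and $\epsilon=0$. Let $\{\hat{\mathbf U}_t\}_{t>t_0}$ be the output of the GREAT algorithm (see context) run with initial estimate $\hat{\mathbf U}_{t_0}$, samples $\{u_t\}$, window length $T$, step size $\alpha$ and $K$ inner iterations. Then $$d_2(\hat{\mathbf U}_t,\mathbf U_t)^2\le\tilde\rho^{K(t-t_0)}\,d_2(\hat{\mathbf U}_{t_0},\mathbf U_{t_0})^2\qquad\text{for all integers }t\ge t_0+1 .$$
   Context: $\mathbb N$ denotes the positive integers. $\operatorname{Gr}(n,d)$ is the Grassmann manifold of $d$-dimensional subspaces of $\mathbb R^n$. A subspace $\mathbf U\in\operatorname{Gr}(n,d)$ is represented by any $U\in\mathbb R^{n\times d}$ with $U^\top U=I_d$ whose columns span $\mathbf U$; $P_{\mathbf U}=UU^\top$ and $P_{\mathbf U}^\perp=I_n-P_{\mathbf U}$. $\sigma_i(A)$ is the $i$-th largest singular value of $A$, and $\|\cdot\|_F$ is the Frobenius norm. Chordal distance: $d_2(\mathbf U,\mathbf V)=(\mathrm{tr}(P_{\mathbf U}^\perp P_{\mathbf V}))^{1/2}=(\sum_{i=1}^d\sin^2\theta_i)^{1/2}$, where $\theta_i$ are the principal angles between $\mathbf U$ and $\mathbf V$. Metric ball: $\mathbb B_r(\mathbf U)=\{\hat{\mathbf U}\in\operatorname{Gr}(n,d): d_2(\mathbf U,\hat{\mathbf U})\le r\}$. Noise bound: for integers $t\ge T$, $$\delta_t:=c\,\|W_tD\|_F+\epsilon\sqrt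 T\,(c(T-1)+1),\qquad D:=\mathrm{diag}(T-1,T-2,\dots,0).$$ For $r\ge 0$ and $s\ge0$, $$\gamma_r(s):=8\alpha r\overline\sigma(1+4\alpha\overline\sigma^2)s+\left(4\alpha r+16\alpha^2\overline\sigma^2(r+2)\right)s^2+32\alpha^2\overline\sigma s^3+8\alpha^2s^4 .$$ Exponential map: for $\mathbf\Gamma\in\operatorname{Gr}(n,d)$ with orthonormal representation $\Gamma$, and a tangent vector represented by $V\in\mathbb R^{n\times d}$ with $\Gamma^\top V=0$ and compact SVD $V=Q_1\mathrm{diag}(s_1,\dots,s_d)Q_2^\top$, $\mathrm{Exp}_{\mathbf\Gamma}(V)$ is the subspace spanned by the columns of $\Gamma Q_2\,\mathrm{diag}(\cos s_i)\,Q_2^\top+Q_1\,\mathrm{diag}(\sin s_i)\,Q_2^\top$. Cost: $F_{W}(\mathbf\Gamma)=\|P_{\mathbf\Gamma}^\perp W\|_F^2$, with Riemannian gradient represented by $\mathrm{grad}\,F_W(\mathbf\Gamma)=-2P_{\mathbf\Gamma}^\perp WW^\top\Gamma$. GREAT algorithm: for $t=t_0+1,t_0+2,\dots$: form $W_t$; set $\mathbf\Gamma_0=\hat{\mathbf U}_{t-1}$; for $k=0,\dots,K-1$ set $\mathbf\Gamma_{k+1}=\mathrm{Exp}_{\mathbf\Gamma_k}(-\alpha\,\mathrm{grad}\,F_{W_t}(\mathbf\Gamma_k))$; set $\hat{\mathbf U}_t=\mathbf\Gamma_K$. *)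

(* Defs.v *)
From HB Require Import structures.
From mathcomp Require Import all_boot all_order all_algebra.
From mathcomp Require Import spectral complex.
From mathcomp Require Import boolp classical_sets reals trigo.

Set Implicit Arguments.
Unset Strict Implicit.
Unset Printing Implicit Defensive.

Import Order.TTheory GRing.Theory Num.Theory.
Local Open Scope ring_scope.

Definition colspan (R : fieldType) n d (M : 'M[R]_(n, d)) :
    {vspace 'cV[R]_n} :=
  <<[seq col j M | j <- enum 'I_d]>>%VS.

Lemma colspanP (R : fieldType) n d (M : 'M[R]_(n, d)) (v : 'cV[R]_n) :
  reflect (exists x : 'cV[R]_d, v = M *m x) (v \in colspan M).
Proof.
have colE_ (x : 'cV[R]_d) : M *m x = \sum_j x j 0 *: col j M.
  apply/colP => i; rewrite !mxE summxE; apply: eq_bigr => j _.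
  by rewrite !mxE mulrC.
apply: (iffP idP) => [|[x ->]]; last first.
  rewrite colE_; apply: memv_suml => j _; apply/memvZ/memv_span.
  by apply: map_f; rewrite mem_enum.
move/(coord_span (X := in_tuple _)) => ->.
elim/big_ind: _ => [|_ _ [x ->] [y ->]|i _].
- by exists 0; rewrite mulmx0.
- by exists (x + y); rewrite mulmxDr.
have : (in_tuple [seq col j M | j <- enum 'I_d])`_i
         \in [seq col j M | j <- enum 'I_d] by rewrite mem_nth.
case/mapP => j _ ->; rewrite colE scalemxAr.
by eexists.
Qed.

(** Frobenius norm; on a column it is the Euclidean norm, unlike the library
    norm of matrices, which is the sup norm. *)
Definition normF (R : rcfType) m n (A : 'M[R]_(m, n)) : R :=
  Num.sqrt (\sum_i \sum_j A i j ^+ 2).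

Lemma normF_eq0 (R : rcfType) m n (A : 'M[R]_(m, n)) :
  (normF A == 0) = (A == 0).
Proof.
rewrite sqrtr_eq0; have s0 i : 0 <= \sum_j A i j ^+ 2.
  by apply: sumr_ge0 => j _; exact: sqr_ge0.
apply/idP/eqP => [|->]; last first.
  by rewrite big1// => i _; rewrite big1// => j _; rewrite mxE expr0n.
move=> le0; apply/matrixP => i j; rewrite mxE; apply/eqP.
have /eqP : \sum_i \sum_j A i j ^+ 2 = 0.
  by apply: le_anti; rewrite le0 sumr_ge0.
rewrite psumr_eq0// => /allP/(_ i); rewrite mem_index_enum => /(_ isT)/=.
rewrite psumr_eq0 => [/allP/(_ j)|k _]; last exact: sqr_ge0.
by rewrite mem_index_enum sqrf_eq0 => /(_ isT).
Qed.

Lemma gram_schmidt (R : rcfType) n (X : seq 'cV[R]_n) : free X ->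
  exists M : 'M[R]_(n, size X), M^T *m M = 1%:M /\ colspan M = <<X>>%VS.
Proof.
elim: X => [_|x X IH].
  exists 0; split; first by apply/matrixP => -[].
  apply/vspaceP => v; rewrite span_nil memv0; apply/colspanP/eqP.
    by case=> y ->; rewrite mul0mx.
  by move=> ->; exists 0; rewrite mulmx0.
rewrite free_cons => /andP[xX /IH[M [MM spM]]] {IH}.
pose v := x - M *m (M^T *m x).
have Mv : M^T *m v = 0 by rewrite mulmxBr (mulmxA M^T) MM mul1mx subrr.
have vn0 : normF v != 0.
  rewrite normF_eq0 subr_eq0; apply: contra xX => /eqP ->.
  by rewrite -spM; apply/colspanP; eexists.
have vv : v^T *m v = (normF v ^+ 2)%:M.
  apply/matrixP => i j; rewrite !ord1 !mxE eqxx mulr1n sqr_sqrtr; last first.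
    by apply: sumr_ge0 => k _; apply: sumr_ge0 => l _; exact: sqr_ge0.
  by apply: eq_bigr => k _; rewrite big_ord1 !mxE expr2.
pose w := (normF v)^-1 *: v.
have vw : v = normF v *: w by rewrite scalerA divff// scale1r.
have Mw : M^T *m w = 0 by rewrite -scalemxAr Mv scaler0.
have wM : w^T *m M = 0 by rewrite -[M]trmxK -trmx_mul Mw trmx0.
have ww : w^T *m w = 1%:M.
  have -> : w^T = (normF v)^-1 *: v^T by apply/matrixP => i j; rewrite !mxE.
  rewrite -scalemxAl -scalemxAr vv scalerA scale_scalar_mx.
  by rewrite -expr2 -exprMn mulVf// expr1n.
pose N : 'M[R]_(n, 1 + size X) := row_mx w M.
have NN : N^T *m N = 1%:M.
  by rewrite /N tr_row_mx mul_col_row ww wM Mw MM -scalar_mx_block.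
exists N; split; first exact: NN.
apply/vspaceP => y; rewrite span_cons -spM; apply/colspanP/idP.
  case=> a ->; pose b : 'cV[R]_(1 + size X) := a.
  have -> : (N : 'M_(n, (size X).+1)) *m a = w *m usubmx b + M *m dsubmx b.
    by rewrite -mul_row_col vsubmxK.
  have -> : w = (normF v)^-1 *: x - M *m ((normF v)^-1 *: (M^T *m x)).
    by rewrite -scalemxAr -scalerBr.
  rewrite mulmxBl -addrA; apply: memv_add.
    by rewrite [usubmx b]mx11_scalar mul_mx_scalar memvZ// memvZ// memv_line.
  rewrite -mulmxA -mulmxN -mulmxDr; apply/colspanP; by eexists.
case/memv_addP => _ /vlineP[k ->] [_ /colspanP[a ->] ->].
pose b : 'cV[R]_(1 + size X) :=
  col_mx (k * normF v)%:M (k *: (M^T *m x) + a).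
exists b; have -> : (N : 'M_(n, (size X).+1)) *m b =
    w *m (k * normF v)%:M + M *m (k *: (M^T *m x) + a).
  by rewrite -mul_row_col.
rewrite mul_mx_scalar -scalerA -vw mulmxDr -scalemxAr addrA.
by rewrite -scalerDr subrK.
Qed.

Definition Gr (R : realType) (n d : nat) : Type :=
  {U : {vspace 'cV[R]_n} | \dim U == d}.

Definition ortho_rep (R : realType) n d (U : Gr R n d) (M : 'M[R]_(n, d)) :
    Prop :=
  M^T *m M = 1%:M /\ colspan M = val U.

Lemma ortho_rep_exists (R : realType) n d (U : Gr R n d) :
  exists M : 'M[R]_(n, d), ortho_rep U M.
Proof.
rewrite /ortho_rep; case: U => U /= /eqP dU.
have [] := gram_schmidt (basis_free (vbasisP U)).
rewrite (span_basis (vbasisP U)) size_tuple; case: d / dU => M HM.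
by exists M.
Qed.

(** The orthogonal projector onto [U]; by [projE] it is [M *m M^T] for every
    orthonormal representation [M] of [U]. *)
Definition proj (R : realType) n d (U : Gr R n d) : 'M[R]_n :=
  let M := sval (cid (ortho_rep_exists U)) in M *m M^T.

Lemma projE (R : realType) n d (U : Gr R n d) (M : 'M[R]_(n, d)) :
  ortho_rep U M -> proj U = M *m M^T.
Proof.
have absorb (A B : 'M[R]_(n, d)) : ortho_rep U A -> ortho_rep U B ->
    A *m A^T *m B = B.
  move=> [AA sA] [_ sB]; apply/matrixP => i j.
  suff : col j (A *m A^T *m B) = col j B by move/colP/(_ i); rewrite !mxE.
  have /colspanP[x Bx] : col j B \in colspan A.
    by rewrite sA -sB; apply/colspanP; exists (delta_mx j 0); rewrite colE.
  by rewrite colE -mulmxA -colE Bx mulmxA -(mulmxA A) AA mulmx1.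
rewrite /proj; case: cid => N /= HN HM.
have NM := absorb _ _ HN HM; have MN := absorb _ _ HM HN.
rewrite -[X in X *m N^T]MN -mulmxA.
have := congr1 (fun X => (X *m M^T)^T) NM.
by rewrite -mulmxA !trmx_mul !trmxK -!mulmxA.
Qed.

Definition proj_perp (R : realType) n d (U : Gr R n d) : 'M[R]_n :=
  1%:M - proj U.

Definition chordal (R : realType) n d (U V : Gr R n d) : R :=
  Num.sqrt (\tr (proj_perp U *m proj V)).

Definition Gr_ball (R : realType) n d (r : R) (U : Gr R n d) :
    set (Gr R n d) :=
  [set V | chordal U V <= r].

Lemma gram_char_poly_split (R : rcfType) m n (A : 'M[R]_(m, n)) :
  exists s : seq R, char_poly (A^T *m A) == \prod_(x <- s) ('X - x%:P).
Proof.
set S := A^T *m A.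
have symS : S^T = S by rewrite trmx_mul trmxK.
pose f := real_complex R; pose H := map_mx f S.
have herm : H \is hermsymmx.
  apply: realsym_hermsym.
    apply/is_hermitianmxP; rewrite expr0 scale1r map_mx_id//.
    by rewrite /H map_trmx symS.
  by apply/mxOverP => i j; rewrite mxE complex_real.
have := hermitian_spectral_diag_real herm.
have /hermitian_normalmx/orthomx_spectralP := herm.
set P := spectralmx H; set D := spectral_diag H => HE /mxOverP Dreal.
have cpH : char_poly H = \prod_i ('X - (D 0 i)%:P).
  have PP : map_mx polyC (invmx P) *m map_mx polyC P = 1%:M.
    by rewrite -map_mxM mulVmx ?spectral_unit// map_mx1.
  have -> : char_poly H = char_poly (diag_mx D).
    rewrite /char_poly; have -> : char_poly_mx H =
        map_mx polyC (invmx P) *m char_poly_mx (diag_mx D) *m map_mx polyC P.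
      rewrite /char_poly_mx [in LHS]HE !map_mxM mulmxBr mulmxBl.
      by rewrite mul_mx_scalar -scalemxAl PP scalemx1.
    by rewrite !det_mulmx mulrAC -det_mulmx PP det1 mul1r.
  rewrite char_poly_trig ?diag_mx_is_trig//; apply: eq_bigr => i _.
  by rewrite mxE eqxx mulr1n.
exists [seq complex.Re (D 0 i) | i <- enum 'I_n].
rewrite -(inj_eq (map_inj_poly (fmorph_inj (real_complex R)) (rmorph0 _))).
rewrite map_char_poly map_prod_XsubC big_map big_enum /= -/H cpH.
apply/eqP/eq_bigr => i _; congr ('X - _%:P).
by rewrite RRe_real//; exact: Dreal.
Qed.

(** The singular values are the square roots of the eigenvalues of
    [A^T *m A], counted with multiplicity.  Here they are listed for all
    columns of [A], so that a wide matrix gets additional trailing zeros. *)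
Definition singular_values (R : rcfType) m n (A : 'M[R]_(m, n)) : seq R :=
  [seq Num.sqrt x |
    x <- sort (fun x y => y <= x) (xchoose (gram_char_poly_split A))].

(** The index [i] starts at 1. *)
Definition singval (R : rcfType) m n (i : nat) (A : 'M[R]_(m, n)) : R :=
  (singular_values A)`_i.-1.

(** The order of the entries of [s] is left free: it does not affect the
    subspace that [is_Exp] builds from the decomposition. *)
Definition compact_svd (R : rcfType) n d (V : 'M[R]_(n, d))
    (Q1 : 'M[R]_(n, d)) (s : 'rV[R]_d) (Q2 : 'M[R]_d) : Prop :=
  [/\ Q1^T *m Q1 = 1%:M, Q2^T *m Q2 = 1%:M, forall i, 0 <= s 0 i
    & V = Q1 *m diag_mx s *m Q2^T].

(** [is_Exp X G V Y]: [Y] is the image under the exponential map at [X] of the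
    tangent vector represented by [V] relative to the orthonormal
    representation [G] of [X]. *)
Definition is_Exp (R : realType) n d (X : Gr R n d) (G V : 'M[R]_(n, d))
    (Y : Gr R n d) : Prop :=
  [/\ ortho_rep X G, G^T *m V = 0 &
    exists Q1 s Q2, compact_svd V Q1 s Q2 /\
      val Y = colspan (G *m Q2 *m diag_mx (map_mx cos s) *m Q2^T
                       + Q1 *m diag_mx (map_mx sin s) *m Q2^T)].

(** The gradient at [X] of the cost [normF (proj_perp X *m W) ^+ 2], relative
    to the orthonormal representation [G] of [X]. *)
Definition grad_cost (R : realType) n d T (W : 'M[R]_(n, T)) (X : Gr R n d)
    (G : 'M[R]_(n, d)) : 'M[R]_(n, d) :=
  (- 2) *: (proj_perp X *m W *m W^T *m G).

Definition grad_step (R : realType) n d T (W : 'M[R]_(n, T)) (alpha : R)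
    (X Y : Gr R n d) : Prop :=
  exists G, is_Exp X G (- alpha *: grad_cost W X G) Y.

(** Columns [u (t - T + 1), ..., u t], for [T <= t]. *)
Definition window (R : realType) n (u : nat -> 'cV[R]_n) (T t : nat) :
    'M[R]_(n, T) :=
  \matrix_(i, j) u (t - T + 1 + j)%N i 0.

Definition GREAT_output (R : realType) n d (u : nat -> 'cV[R]_n) (T : nat)
    (alpha : R) (K t0 : nat) (Uhat : nat -> Gr R n d) : Prop :=
  forall t, (t0 < t)%N -> exists X : nat -> Gr R n d,
    [/\ X 0%N = Uhat t.-1,
        forall k, (k < K)%N -> grad_step (window u T t) alpha (X k) (X k.+1)
      & Uhat t = X K].

Definition noise_bound (R : realType) n (u : nat -> 'cV[R]_n) (T : nat)
    (c eps : R) (t : nat) : R :=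
  let D : 'M[R]_T := diag_mx (\row_(j < T) (T - 1 - j)%N%:R) in
  c * normF (window u T t *m D)
  + eps * Num.sqrt T%:R * (c * (T%:R - 1) + 1).

Definition gamma (R : realType) (alpha sbar r s : R) : R :=
  8 * alpha * r * sbar * (1 + 4 * alpha * sbar ^+ 2) * s
  + (4 * alpha * r + 16 * alpha ^+ 2 * sbar ^+ 2 * (r + 2)) * s ^+ 2
  + 32 * alpha ^+ 2 * sbar * s ^+ 3
  + 8 * alpha ^+ 2 * s ^+ 4.

(* Main.v *)
(** The idea.  With [c = 0] and [eps = 0] the subspaces [U t] all have the same
    projector [P], and [P *m W = W] for every window [W].  Put
    [S = W *m W^T], so that [slow^2 P <= S <= sbar^2 P], and let
    [e = \tr ((1 - proj X) *m P)] be the squared chordal error of an iterate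
    [X].  The gradient step moves [Q = proj X] along the geodesic
    [Q' = J Q - Q J] where [J = kappa (S Q(0) - Q(0) S)] and
    [kappa = 2 alpha], so one has to bound [f(t) = \tr (P *m Q(t))] from below.
    Its initial slope is [2 kappa \tr ((1 - P) Q(0) S Q(0))], which is at least
    [2 kappa slow^2 q] for [q = |(1 - P) Q(0) P|^2].  The point is that the
    second order term is controlled by the same quantity [q], and not merely by
    [e]: as [(1 - P) S = 0], both derivatives of [f] only see the off-diagonal
    block [(1 - P) Q(t) P], whose norm grows at most linearly in [t], and
    [f'' >= - 4 (kappa sbar^2)^2 q] on [[0, 1]].  Finally
    [q >= e (1 - e) >= e (1 - rb^2)]. *)
From HB Require Import structures.
Require Import Defs.
From mathcomp Require Import all_boot all_order all_algebra.
From mathcomp Require Import ring lra.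
From mathcomp Require Import spectral complex.
From mathcomp Require Import boolp classical_sets functions reals topology.
From mathcomp Require Import normedtype derive realfun trigo.

Set Implicit Arguments.
Unset Strict Implicit.
Unset Printing Implicit Defensive.

Import Order.TTheory GRing.Theory Num.Theory.
Import numFieldNormedType.Exports.
Local Open Scope ring_scope.

(** * Squared Frobenius norms and orthogonal projectors *)

(** Kept squared and written as a trace, so that estimates stay polynomial and cyclicity of the
    trace applies directly. *)
Definition sqF (R : pzRingType) m n (A : 'M[R]_(m, n)) : R := \tr (A *m A^T).

Definition orthoproj (R : pzRingType) n (P : 'M[R]_n) : Prop :=
  P^T = P /\ P *m P = P.

Lemma trmxZ (R : pzRingType) m n a (A : 'M[R]_(m, n)) : (a *: A)^T = a *: A^T.
Proof. by apply/matrixP => i j; rewrite !mxE. Qed.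

Lemma mxtraceN (R : pzRingType) n (A : 'M[R]_n) : \tr (- A) = - \tr A.
Proof. exact: raddfN. Qed.

Lemma mxtraceB (R : pzRingType) n (A B : 'M[R]_n) : \tr (A - B) = \tr A - \tr B.
Proof. exact: raddfB. Qed.

Section FrobeniusNorm.
Variable R : realFieldType.

Lemma sqFE m n (A : 'M[R]_(m, n)) : sqF A = \sum_i \sum_j A i j ^+ 2.
Proof.
rewrite /sqF /mxtrace; apply: eq_bigr => i _; rewrite mxE.
by apply: eq_bigr => j _; rewrite mxE expr2.
Qed.

Lemma sqF_ge0 m n (A : 'M[R]_(m, n)) : 0 <= sqF A.
Proof.
by rewrite sqFE; apply: sumr_ge0 => i _; apply: sumr_ge0 => j _; exact: sqr_ge0.
Qed.

Lemma sqF_eq0 m n (A : 'M[R]_(m, n)) : sqF A = 0 -> A = 0.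
Proof.
rewrite sqFE => /eqP; rewrite psumr_eq0 => [/allP h|i _]; last first.
  by apply: sumr_ge0 => j _; exact: sqr_ge0.
apply/matrixP => i j; rewrite mxE.
have := h i; rewrite mem_index_enum => /(_ isT) /=.
rewrite psumr_eq0 => [/allP/(_ j)|k _]; last exact: sqr_ge0.
by rewrite mem_index_enum sqrf_eq0 => /(_ isT) /eqP.
Qed.

Lemma sqFZ m n a (A : 'M[R]_(m, n)) : sqF (a *: A) = a ^+ 2 * sqF A.
Proof. by rewrite /sqF trmxZ -scalemxAl -scalemxAr scalerA mxtraceZ expr2. Qed.

Lemma mxtrace_dotC m n (A B : 'M[R]_(m, n)) : \tr (A *m B^T) = \tr (B *m A^T).
Proof. by rewrite -mxtrace_tr trmx_mul trmxK. Qed.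

Lemma sqFD m n (A B : 'M[R]_(m, n)) :
  sqF (A + B) = sqF A + 2 * \tr (A *m B^T) + sqF B.
Proof.
rewrite /sqF linearD /= mulmxDl !mulmxDr !mxtraceD [\tr (B *m A^T)]mxtrace_dotC.
by ring.
Qed.

Lemma sqFB m n (A B : 'M[R]_(m, n)) :
  sqF (A - B) = sqF A - 2 * \tr (A *m B^T) + sqF B.
Proof.
rewrite sqFD linearN /= mulmxN linearN /= -[- B]scaleN1r sqFZ.
by ring.
Qed.

Lemma sqFB_le m n (A B : 'M[R]_(m, n)) : sqF (A - B) <= 2 * (sqF A + sqF B).
Proof. by have := sqF_ge0 (A + B); rewrite sqFD sqFB; lra. Qed.

(** Expand [0 <= sqF (a *: A - B)] and divide by [a]. The weight stays free because it is tuned to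
    the point of the geodesic in one use and to the step size in another. *)
Lemma mxtrace_AMGM m n (A B : 'M[R]_(m, n)) (a : R) : 0 < a ->
  2 * \tr (A *m B^T) <= a * sqF A + sqF B / a.
Proof.
move=> a0; have := sqF_ge0 (a *: A - B).
rewrite sqFB sqFZ -scalemxAl mxtraceZ => h; rewrite -subr_ge0.
have -> : a * sqF A + sqF B / a - 2 * \tr (A *m B^T) =
    (a ^+ 2 * sqF A - 2 * (a * \tr (A *m B^T)) + sqF B) / a.
  by field; rewrite gt_eqF.
by rewrite divr_ge0// ltW.
Qed.

Lemma mxtrace_CauchySchwarz m n (A B : 'M[R]_(m, n)) :
  \tr (A *m B^T) ^+ 2 <= sqF A * sqF B.
Proof.
have [/sqF_eq0 ->|B0] := eqVneq (sqF B) 0.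
  by rewrite trmx0 mulmx0 mxtrace0 expr0n /= /sqF mul0mx mxtrace0 mulr0.
have Bgt0 : 0 < sqF B by rewrite lt_neqAle eq_sym B0 sqF_ge0.
have := sqF_ge0 (sqF B *: A - \tr (A *m B^T) *: B).
rewrite sqFB !sqFZ trmxZ -scalemxAl -scalemxAr scalerA mxtraceZ.
set t := \tr _ => h.
rewrite -subr_ge0 -(pmulr_rge0 _ Bgt0); apply: le_trans h _.
by rewrite le_eqVlt; apply/orP; left; apply/eqP; ring.
Qed.

(** Each entry of [A *m A^T] is an inner product of two rows. Cauchy-Schwarz bounds its square by
    the product of their squared norms, and these products sum to [sqF A ^+ 2]. *)
Lemma sqF_gram_le m n (A : 'M[R]_(m, n)) : sqF (A *m A^T) <= sqF A ^+ 2.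
Proof.
have rowE : sqF A = \sum_i sqF (row i A).
  rewrite sqFE; apply: eq_bigr => i _; rewrite sqFE big_ord1.
  by apply: eq_bigr => j _; rewrite mxE.
rewrite sqFE [in leRHS]rowE expr2 mulr_suml; apply: ler_sum => i _.
rewrite mulr_sumr; apply: ler_sum => j _.
apply: le_trans (mxtrace_CauchySchwarz (row i A) (row j A)).
rewrite le_eqVlt; apply/orP; left; apply/eqP; congr (_ ^+ 2).
rewrite trace_mx11 !mxE; by apply: eq_bigr => k _; rewrite !mxE.
Qed.

Lemma orthoprojC n (P : 'M[R]_n) : orthoproj P -> orthoproj (1%:M - P).
Proof.
move=> [sP iP]; split; first by rewrite linearB /= sP trmx1.
by rewrite mulmxBr !mulmxBl !mulmx1 !mul1mx iP subrr subr0.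
Qed.

Lemma orthoproj_orth n d (G : 'M[R]_(n, d)) :
  G^T *m G = 1%:M -> orthoproj (G *m G^T).
Proof.
by move=> GG; split; rewrite ?trmx_mul ?trmxK// mulmxA -(mulmxA G) GG mulmx1.
Qed.

Lemma sqF_mulproj m n (N : 'M[R]_(m, n)) (P : 'M[R]_n) :
  orthoproj P -> sqF (N *m P) = \tr (N *m P *m N^T).
Proof. by move=> [sP iP]; rewrite /sqF trmx_mul sP !mulmxA -(mulmxA _ P P) iP. Qed.

Lemma sqF_mulproj_le m n (N : 'M[R]_(m, n)) (P : 'M[R]_n) :
  orthoproj P -> sqF (N *m P) <= sqF N.
Proof.
move=> oP; have := sqF_ge0 (N *m (1%:M - P)).
rewrite (sqF_mulproj _ oP) (sqF_mulproj _ (orthoprojC oP)).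
by rewrite mulmxBr mulmxBl mulmx1 linearB /= subr_ge0.
Qed.

Lemma mxtrace_projmul n (A B : 'M[R]_n) : orthoproj A -> orthoproj B ->
  \tr (A *m B) = sqF (A *m B).
Proof.
move=> [sA iA] [sB iB].
rewrite /sqF trmx_mul sA sB !mulmxA -(mulmxA _ B B) iB.
by rewrite [RHS]mxtrace_mulC mulmxA iA.
Qed.

(** The compression [C = P Q P] lies between 0 and 1, hence [C^2 <= C] and
    [(C - 1/2)^2 = C^2 - C + 1/4 <= 1/4]. *)
Lemma sqF_compression_half m n (N : 'M[R]_(m, n)) (P Q : 'M[R]_n) :
  orthoproj P -> orthoproj Q ->
  sqF (N *m (P *m Q *m P) - 2^-1 *: N) <= 4^-1 * sqF N.
Proof.
move=> oP oQ; rewrite sqFB sqFZ trmxZ -scalemxAr mxtraceZ.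
have -> : \tr (N *m (P *m Q *m P) *m N^T) = sqF (N *m P *m Q).
  by rewrite (sqF_mulproj _ oQ) trmx_mul oP.1 !mulmxA.
have : sqF (N *m (P *m Q *m P)) <= sqF (N *m P *m Q).
  by rewrite !mulmxA; apply: sqF_mulproj_le.
by lra.
Qed.

Lemma sqF_reflection m n (N : 'M[R]_(m, n)) (P Q : 'M[R]_n) :
  orthoproj P -> orthoproj Q ->
  sqF (N - 2 *: (N *m (P *m Q *m P))) <= sqF N.
Proof.
move=> oP oQ; have := sqF_compression_half N oP oQ.
have -> : N - 2 *: (N *m (P *m Q *m P)) =
   (- 2) *: (N *m (P *m Q *m P) - 2^-1 *: N).
  rewrite scalerBr scalerA mulNr divff ?pnatr_eq0// scaleN1r opprK addrC.
  by rewrite scaleNr.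
rewrite sqFZ; lra.
Qed.

(** With [r] the trace on the left and [M = P (1 - Q) P], which is positive semidefinite of trace
    [r], the right-hand side is exactly [r - \tr (M *m M)], and [\tr (M *m M) <= r^2 <= e r]. *)
Lemma defect_ge n (P Q : 'M[R]_n) (e : R) : orthoproj P -> orthoproj Q ->
  \tr ((1%:M - Q) *m P) <= e ->
  (1 - e) * \tr ((1%:M - Q) *m P) <= \tr ((1%:M - P) *m Q *m P *m Q).
Proof.
move=> oP oQ; have oQ' := orthoprojC oQ.
set M := P *m (1%:M - Q) *m P; set r := \tr (_ *m P) => re.
have ME : M = (P *m (1%:M - Q)) *m (P *m (1%:M - Q))^T.
  by rewrite trmx_mul oP.1 oQ'.1 mulmxA -(mulmxA P (1%:M - Q)) oQ'.2.
have rE : r = sqF (P *m (1%:M - Q)).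
  by rewrite -mxtrace_projmul// mxtrace_mulC.
have trM2 : \tr (M *m M) <= e * r.
  have -> : \tr (M *m M) = sqF M.
    by rewrite /sqF (_ : M^T = M)// ME trmx_mul trmxK.
  rewrite ME; apply: le_trans (sqF_gram_le _) _.
  rewrite -rE expr2; apply: ler_wpM2r => //.
  by rewrite rE sqF_ge0.
suff -> : \tr ((1%:M - P) *m Q *m P *m Q) = r - \tr (M *m M) by lra.
have MM : M *m M = P *m (1%:M - Q) *m P *m (1%:M - Q) *m P.
  by rewrite /M !mulmxA -(mulmxA _ P P) oP.2.
rewrite MM /r.
have -> : \tr (P *m (1%:M - Q) *m P *m (1%:M - Q) *m P) =
    \tr (P *m (1%:M - Q) *m P *m (1%:M - Q)).
  by rewrite mxtrace_mulC !mulmxA oP.2.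
rewrite !(mulmxBr, mulmxBl) !(mulmx1, mul1mx) oP.2 !mxtraceB.
rewrite -(mulmxA (P *m Q) P Q) -(mulmxA Q P Q).
rewrite [\tr (P *m Q *m P)]mxtrace_mulC !mulmxA oP.2.
rewrite -(mulmxA Q P) [\tr (Q *m (P *m Q))]mxtrace_mulC -(mulmxA P Q Q) oQ.2.
by rewrite [\tr (Q *m P)]mxtrace_mulC; lra.
Qed.

End FrobeniusNorm.

(** * Singular values *)

(** Selecting the rows and columns of the nonzero entries leaves an invertible diagonal block, and
    selection cannot raise the rank. *)
Lemma card_support_le_rank (F : fieldType) n (v : 'rV[F]_n) :
  (#|[pred i | v 0 i != 0]%R| <= \rank (diag_mx v))%N.
Proof.
set I := [pred i | v 0 i != 0].
pose f (k : 'I_#|I|) : 'I_n := enum_val k.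
have injf : injective f by exact: enum_val_inj.
have -> : #|I| = \rank (mxsub f f (diag_mx v)).
  have -> : mxsub f f (diag_mx v) = diag_mx (\row_k v 0 (f k)).
    apply/matrixP => i j; rewrite !mxE (inj_eq injf); by case: eqP => // ->.
  apply/esym/eqP/row_freeP.
  exists (diag_mx (\row_k (v 0 (f k))^-1)).
  rewrite mulmx_diag; apply/matrixP => i j; rewrite !mxE mulfV//.
  by have := enum_valP i.
have -> : mxsub f f (diag_mx v) = rowsub f 1%:M *m diag_mx v *m colsub f 1%:M.
  rewrite mulmx_colsub mulmx1 -rowsubE.
  by apply/matrixP => i j; rewrite !mxE.
by apply: leq_trans (mxrankM_maxl _ _) _; exact: mxrankM_maxr.
Qed.

Section GramSpectrum.
Local Open Scope sesquilinear_scope.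

(** A spectral theorem that hides the eigenbasis, which is obtained over [R[i]]. Only real data
    leave the lemma: the eigenvalues [D] and the weights [w] of [N] on the eigenvectors, so that
    norm inequalities can be checked term by term. *)
Lemma gram_spectrum (R : rcfType) m n (A : 'M[R]_(m, n)) :
  exists D : 'I_n -> R,
  [/\ char_poly (A^T *m A) = \prod_i ('X - (D i)%:P),
      (#|[pred i | D i != 0]%R| <= \rank A)%N &
      forall p (N : 'M[R]_(p, n)), exists w : 'I_n -> R,
      [/\ forall i, 0 <= w i, sqF N = \sum_i w i,
          sqF (N *m A^T) = \sum_i D i * w i &
          sqF (N *m A^T *m A) = \sum_i D i ^+ 2 * w i]].
Proof.
set S := A^T *m A.
have symS : S^T = S by rewrite trmx_mul trmxK.
pose f : {rmorphism R -> R[i]} := real_complex R; pose H := map_mx f S.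
have herm : H \is hermsymmx.
  apply: realsym_hermsym.
    apply/is_hermitianmxP; rewrite expr0 scale1r map_mx_id//.
    by rewrite /H map_trmx symS.
  by apply/mxOverP => i j; rewrite mxE complex_real.
have := hermitian_spectral_diag_real herm.
have /hermitian_normalmx/orthomx_spectralP := herm.
have unitP := spectral_unitarymx H.
rewrite invmx_unitary//.
set P := spectralmx H in unitP *; set D := spectral_diag H => HE /mxOverP Dreal.
have PP : P *m P^t* = 1%:M by apply/unitarymxP.
have PP' : P^t* *m P = 1%:M.
  by rewrite -invmx_unitary// mulVmx// unitarymx_unit.
pose d i := complex.Re (D 0 i).
have dE i : D 0 i = f (d i) by apply/esym/RRe_real; exact: Dreal.
exists d; split.
- apply: (map_inj_poly (fmorph_inj f) (rmorph0 _)).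
  rewrite map_char_poly -/H rmorph_prod /=.
  have -> : char_poly H = char_poly (diag_mx D).
    have PPX : map_mx polyC (P^t*) *m map_mx polyC P = 1%:M.
      by rewrite -map_mxM PP' map_mx1.
    rewrite /char_poly; have -> : char_poly_mx H =
        map_mx polyC (P^t*) *m char_poly_mx (diag_mx D) *m map_mx polyC P.
      rewrite /char_poly_mx [in LHS]HE !map_mxM mulmxBr mulmxBl.
      by rewrite mul_mx_scalar -scalemxAl PPX scalemx1.
    by rewrite !det_mulmx mulrAC -det_mulmx PPX det1 mul1r.
  rewrite char_poly_trig ?diag_mx_is_trig//; apply: eq_bigr => i _.
  by rewrite mxE eqxx mulr1n map_polyXsubC dE.
- have -> : #|[pred i | d i != 0]| = #|[pred i | D 0 i != 0]|.
    by apply: eq_card => i; rewrite !inE dE fmorph_eq0.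
  apply: leq_trans (card_support_le_rank D) _.
  have -> : diag_mx D = P *m H *m P^t*.
    by rewrite HE !mulmxA PP mul1mx -mulmxA PP mulmx1.
  apply: leq_trans (mxrankM_maxl _ _) _; apply: leq_trans (mxrankM_maxr _ _) _.
  by rewrite mxrank_map; exact: mxrankM_maxr.
move=> p N; pose Y := map_mx f N *m P^t*.
pose w i := \sum_k (complex.Re (Y k i) ^+ 2 + complex.Im (Y k i) ^+ 2).
have wE i : f (w i) = \sum_k Y k i * (Y k i)^*.
  rewrite /w rmorph_sum /=; apply: eq_bigr => k _.
  case: (Y k i) => a b /=; apply/eqP; rewrite eq_complex /=.
  apply/andP; split; apply/eqP; ring.
(* One trace formula for every [B] diagonal in this eigenbasis; it is applied to the identity, to
   [S] and to [S *m S]. *)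
have trE (v : 'I_n -> R) (B : 'M[R]_n) :
    map_mx f B = P^t* *m diag_mx (\row_i f (v i)) *m P ->
    \tr (N *m B *m N^T) = \sum_i v i * w i.
  move=> BE; apply: (fmorph_inj f); rewrite -trace_map_mx !map_mxM BE.
  rewrite rmorph_sum /=.
  have -> : map_mx f N^T = (map_mx f N)^t*.
    apply/matrixP => i j; rewrite !mxE; apply/esym/conj_Creal.
    by rewrite complex_real.
  have -> : map_mx f N *m (P^t* *m diag_mx (\row_i f (v i)) *m P)
      *m (map_mx f N)^t* =
      Y *m diag_mx (\row_i f (v i)) *m Y^t*.
    rewrite /Y trmx_mul map_mxM /= !mulmxA; congr (_ *m _ *m _).
    by apply/matrixP => i j; rewrite !mxE conjCK.
  rewrite mul_mx_diag /mxtrace.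
  under [LHS]eq_bigr do rewrite mxE.
  rewrite exchange_big; apply: eq_bigr => i _.
  rewrite rmorphM /= wE mulr_sumr; apply: eq_bigr => k _.
  by rewrite !mxE; ring.
exists w; split.
- by move=> i; apply: sumr_ge0 => k _; rewrite addr_ge0// sqr_ge0.
- have -> : sqF N = \tr (N *m 1%:M *m N^T) by rewrite mulmx1.
  rewrite (trE (fun=> 1)).
    by apply: eq_bigr => i _; rewrite mul1r.
  rewrite map_mx1 (_ : diag_mx _ = 1%:M) ?mulmx1 ?PP'//.
  by rewrite rmorph1; apply/matrixP => i j; rewrite !mxE.
- rewrite /sqF trmx_mul trmxK !mulmxA -(mulmxA N) (trE d)// -/S -/H {1}HE.
  by rewrite (_ : \row_i f (d i) = D)//; apply/rowP => i; rewrite mxE dE.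
- have -> : sqF (N *m A^T *m A) = \tr (N *m (S *m S) *m N^T).
    by rewrite /sqF !trmx_mul trmxK /S !mulmxA.
  rewrite (trE (fun i => d i ^+ 2))//.
  have -> : map_mx f (S *m S) = P^t* *m (diag_mx D *m diag_mx D) *m P.
    by rewrite map_mxM -/H HE !mulmxA mulmxtVK.
  rewrite mulmx_diag (_ : \row_j (D 0 j * D 0 j) = \row_i f (d i ^+ 2))//.
  by apply/rowP => i; rewrite !mxE dE rmorphXn expr2.
Qed.

End GramSpectrum.

(** [singular_values] sorts an arbitrarily chosen list of roots. Unique factorization into linear
    factors makes that list a permutation of any other list of eigenvalues. *)
Lemma singval_spectrum (R : rcfType) m n (A : 'M[R]_(m, n)) (D : 'I_n -> R) :
  char_poly (A^T *m A) = \prod_i ('X - (D i)%:P) ->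
  exists s : seq R, [/\ perm_eq s [seq D i | i <- enum 'I_n],
    sorted >=%O s & forall i, (0 < i <= n)%N -> singval i A = Num.sqrt s`_i.-1].
Proof.
move=> cpE; rewrite /singval /singular_values; set x := xchoose _.
have /eqP xE := xchooseP (gram_char_poly_split A); rewrite -/x in xE.
have px : perm_eq x [seq D i | i <- enum 'I_n].
  by apply: prod_XsubC_eq; rewrite -xE cpE big_map big_enum.
exists (sort (fun x y => y <= x) x); split.
- by rewrite perm_sort.
- by apply: sort_sorted => a b; exact: le_total.
move=> i /andP[i0 lein]; rewrite (nth_map 0)// size_sort (perm_size px).
by rewrite size_map size_enum_ord prednK.
Qed.

Lemma sqF_mul_le_singval1 (R : rcfType) m n p (A : 'M[R]_(m, n))
    (N : 'M[R]_(p, n)) (b : R) :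
  singval 1 A <= b -> sqF (N *m A^T) <= b ^+ 2 * sqF N.
Proof.
case: (gram_spectrum A) => D [cpE _ /(_ p N)[w [w0 -> -> _]]].
case: (singval_spectrum cpE) => s [ps ss sE] hb.
rewrite mulr_sumr; apply: ler_sum => i _; apply: ler_wpM2r => //.
rewrite sE in hb; last by rewrite /= (leq_ltn_trans _ (ltn_ord i)).
have Dis : D i \in s by rewrite (perm_mem ps) map_f// mem_enum.
have Dle : D i <= s`_0.
  rewrite -(nth_index 0 Dis).
  have lts : (index (D i) s < size s)%N by rewrite index_mem.
  by apply: (sorted_leq_nth ge_trans ge_refl) => //;
    rewrite inE (leq_ltn_trans _ lts).
(* The sign of [D i] is not part of the spectral data, and [Num.sqrt] sends negative numbers to 0; a
   negative [D i] is below the square [b ^+ 2] anyway. *)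
have [D0|/ltW D0] := leP 0 (D i); last by rewrite (le_trans D0)// sqr_ge0.
apply: (le_trans Dle).
rewrite -(sqr_sqrtr (le_trans D0 Dle)) ler_pXn2r// ?nnegrE ?sqrtr_ge0//.
exact: le_trans (sqrtr_ge0 _) hb.
Qed.

(* The d-th largest eigenvalue of A^T A is positive while A has rank at most d,
   so every nonzero eigenvalue is at least a^2. *)
Lemma sqF_mul_ge_singval (R : rcfType) m n d (A : 'M[R]_(m, n)) (a : R) :
  (0 < d <= n)%N -> (\rank A <= d)%N -> 0 < a -> a <= singval d A ->
  \rank A = d /\
  forall p (N : 'M[R]_(p, n)), a ^+ 2 * sqF (N *m A^T) <= sqF (N *m A^T *m A).
Proof.
move=> dn rkA a0; case: (gram_spectrum A) => D [cpE rkD wE].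
case: (singval_spectrum cpE) => s [ps ss sE]; rewrite sE// => ale.
have [d0 ledn] := andP dn.
have szs : size s = n by rewrite (perm_size ps) size_map size_enum_ord.
pose big := [pred i | a ^+ 2 <= D i].
have a20 : 0 < a ^+ 2 by rewrite exprn_gt0.
(* The first [d] entries of the decreasing list [s] all dominate the entry of index [d.-1], which is
   at least [a ^+ 2]. *)
have cbig : (d <= #|big|)%N.
  have -> : #|big| = count [pred x | a ^+ 2 <= x] s.
    rewrite (permP ps) count_map enumT cardE /enum_mem size_filter.
    by apply: eq_count => i; rewrite /= !inE.
  rewrite -{1}(size_takel (s := s) (n0 := d)) ?szs//.
  apply: (@leq_trans (count [pred x | a ^+ 2 <= x] (take d s))); last first.
    by rewrite -[in leqRHS](cat_take_drop d s) count_cat leq_addr.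
  suff : all [pred x | a ^+ 2 <= x] (take d s) by rewrite all_count => /eqP ->.
  apply/(all_nthP 0) => i; rewrite size_takel ?szs// => id /=.
  rewrite nth_take//.
  have : s`_d.-1 <= s`_i.
    apply: (sorted_leq_nth ge_trans ge_refl) => //; rewrite ?inE ?szs.
    - exact: leq_trans id ledn.
    - by rewrite prednK.
    - by rewrite -ltnS prednK.
  apply: le_trans.
  have s0 : 0 <= s`_d.-1.
    by rewrite leNgt; apply/negP => /ltW/ler0_sqrtr h; move: ale; rewrite h leNgt a0.
  by rewrite -(sqr_sqrtr s0) ler_pXn2r// ?nnegrE ?sqrtr_ge0// ltW.
have sub : {subset big <= [pred i | D i != 0]}.
  by move=> i; rewrite !inE => h; rewrite gt_eqF// (lt_le_trans a20).
have leb : (#|big| <= #|[pred i | D i != 0%R]|)%N.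
  by apply: subset_leq_card; apply/fintype.subsetP.
have rkE : \rank A = d.
  by apply/eqP; rewrite eqn_leq rkA (leq_trans cbig)// (leq_trans leb).
split=> // p N; case: (wE p N) => w [w0 _ -> ->].
rewrite mulr_sumr; apply: ler_sum => i _; rewrite mulrA; apply: ler_wpM2r => //.
have [->|Di] := eqVneq (D i) 0; first by rewrite mulr0 expr0n.
(* The chain [d <= #|big| <= #|support of D| <= \rank A = d] collapses, so [big] is the whole
   support. *)
have : i \in big.
  have e : #|big| = #|[pred i | D i != 0%R]|.
    by apply/eqP; rewrite eqn_leq leb (leq_trans rkD)// rkE.
  by have /(subset_cardP e) -> : big \subset [pred i | D i != 0]
    by apply/fintype.subsetP.
rewrite inE => h; rewrite expr2; apply: ler_wpM2r => //.
by rewrite (le_trans _ h)// ltW.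
Qed.

(** * Derivatives *)

Section RealCalculus.
Variable R : realType.
Implicit Types f g : R -> R.

Lemma is_deriveBf f g (t a b : R) :
  is_derive t 1 f a -> is_derive t 1 g b ->
  is_derive t 1 (fun s => f s - g s) (a - b).
Proof. exact: is_deriveB. Qed.

Lemma is_deriveMf f g (t a b : R) :
  is_derive t 1 f a -> is_derive t 1 g b ->
  is_derive t 1 (fun s => f s * g s) (a * g t + f t * b).
Proof.
move=> df dg; apply: is_derive_eq (is_deriveM df dg) _.
by rewrite /GRing.scale /= addrC mulrC.
Qed.

Lemma is_deriveMlf f (t a c : R) :
  is_derive t 1 f a -> is_derive t 1 (fun s => c * f s) (c * a).
Proof. exact: is_deriveZ. Qed.

Lemma is_derive_le0_nincr f g (a b : R) : a <= b ->
  (forall t, a <= t <= b -> is_derive t 1 f (g t)) ->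
  (forall t, a <= t <= b -> g t <= 0) -> f b <= f a.
Proof.
move=> ab df g0.
have inI t : t \in `]a, b[ -> a <= t <= b.
  by rewrite in_itv /= => /andP[/ltW -> /ltW ->].
apply: (@ler0_derive1_nincr _ f a b) => // [t /inI tI|t /inI tI|].
- by case: (df _ tI).
- by rewrite derive1E; case: (df _ tI) => _ ->; exact: g0.
- apply: derivable_within_continuous => t; rewrite in_itv /= => tI.
  by case: (df _ tI).
Qed.

(** Monotonicity used twice: the bound on [f''] puts [f'] above a line, and this puts [f] above a
    parabola. *)
Lemma second_order_lower_bound (f f' f'' : R -> R) (c : R) :
  (forall t : R, is_derive t 1 f (f' t)) ->
  (forall t : R, is_derive t 1 f' (f'' t)) ->
  (forall t, 0 <= t <= 1 -> - c <= f'' t) -> f 0 + f' 0 - c / 2 <= f 1.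
Proof.
move=> df df' hc.
have lin s : 0 <= s <= 1 -> f' 0 - c * s <= f' s.
  move=> /andP[s0 s1].
  have h (t : R) : is_derive t 1 (fun t => - f' t - c * t) (- f'' t - c).
    apply: is_derive_eq (is_deriveBf (is_deriveN (df' t))
      (is_deriveMlf c (is_derive_id t 1))) _.
    by rewrite mulr1.
  have := @is_derive_le0_nincr _ _ 0 s s0 (fun t _ => h t) _.
  have -> : (- f' s - c * s <= - f' 0 - c * 0) = (f' 0 - c * s <= f' s).
    by apply/idP/idP; lra.
  apply=> t /andP[t0 ts]; have := hc t; rewrite t0 (le_trans ts s1) => /(_ isT).
  lra.
have h (t : R) : is_derive t 1 (fun t => f' 0 * t - c / 2 * (t * t) - f t)
    (f' 0 - c * t - f' t).
  apply: is_derive_eq (is_deriveBf (is_deriveBf (is_deriveMlf (f' 0)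
    (is_derive_id t 1)) (is_deriveMlf (c / 2)
    (is_deriveMf (is_derive_id t 1) (is_derive_id t 1)))) (df t)) _.
  by field.
have := @is_derive_le0_nincr _ _ 0 1 ler01 (fun t _ => h t) _.
rewrite !(mulr0, mulr1) => H.
suff : f' 0 - c / 2 - f 1 <= 0 - 0 - f 0 by lra.
by apply: H => t /lin; lra.
Qed.

(* The hypothesis on y' is what AM-GM makes of y' <= 2 sqrt (q y), so the
   conclusion is that sqrt y grows at rate at most sqrt q. *)
Lemma sqr_growth (y y' : R -> R) (q : R) :
  (forall t : R, is_derive t 1 y (y' t)) ->
  (forall t, 0 <= t <= 1 -> y' t <= y t / (1 + t) + (1 + t) * q) ->
  y 0 <= q -> forall t, 0 <= t <= 1 -> y t <= (1 + t) ^+ 2 * q.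
Proof.
move=> dy hy y0 s /andP[s0 s1].
(* The hypothesis on [y'] says precisely that [g] is nonincreasing, so [g s <= y 0 <= q]. *)
pose g t := y t * (1 + t)^-1 - q * t.
have dg (t : R) : 0 <= t <= s -> is_derive t 1 g
    (y' t / (1 + t) - y t / (1 + t) ^+ 2 - q).
  move=> /andP[t0 _]; have t1 : 1 + t != 0 by rewrite gt_eqF//; lra.
  rewrite /g.
  have dV : is_derive t 1 (fun t => (1 + t)^-1) (- (1 + t) ^- 2).
    have d1 : is_derive t 1 (cst 1 + id : R -> R) (0 + 1).
      by apply: is_deriveD.
    apply: is_derive_eq (is_deriveV (f := cst 1 + id) t1 d1) _.
    by rewrite /GRing.scale /= add0r mulr1.
  apply: is_derive_eq (is_deriveBf (is_deriveMf (dy t) dV)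
    (is_deriveMlf q (is_derive_id t 1))) _.
  by field.
have := is_derive_le0_nincr s0 dg; rewrite /g.
rewrite addr0 invr1 mulr0 subr0 mulr1 => H.
have {H} : y s / (1 + s) - q * s <= y 0.
  apply: H => t /andP[t0 ts].
  have t1 : 0 < 1 + t by lra.
  have := hy t; rewrite t0 (le_trans ts s1) => /(_ isT) h.
  have -> : y' t / (1 + t) - y t / (1 + t) ^+ 2 - q =
     (y' t - (y t / (1 + t) + (1 + t) * q)) / (1 + t).
    by field; rewrite gt_eqF.
  by rewrite ler_pdivrMr// mul0r subr_le0.
have s1' : 0 < 1 + s by lra.
move=> H; have : y s / (1 + s) <= q * (1 + s) by lra.
by rewrite ler_pdivrMr//; lra.
Qed.

End RealCalculus.

(** * Entrywise derivatives of matrix-valued functions *)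

Section MatrixCalculus.
Variable R : realType.

Definition is_mxderive m n (F F' : R -> 'M[R]_(m, n)) : Prop :=
  forall (t : R) i j, is_derive t 1 (fun t => F t i j) (F' t i j).

Lemma is_mxderive_eq m n (F F' G' : R -> 'M[R]_(m, n)) :
  is_mxderive F F' -> F' =1 G' -> is_mxderive F G'.
Proof. by move=> dF e t i j; rewrite -e. Qed.

Lemma is_derive_sumf n (h : 'I_n -> R -> R) (dh : 'I_n -> R) (t : R) :
  (forall i, is_derive t 1 (h i) (dh i)) ->
  is_derive t 1 (fun t => \sum_i h i t) (\sum_i dh i).
Proof.
move=> H; have -> : (fun t => \sum_i h i t) = \sum_i h i.
  by apply/funext => s; rewrite fct_sumE.
exact: is_derive_sum.
Qed.

Lemma is_mxderive_cst m n (M : 'M[R]_(m, n)) : is_mxderive (fun=> M) (fun=> 0).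
Proof. by move=> t i j; rewrite mxE; exact: is_derive_cst. Qed.

Lemma is_mxderiveM m n p (F F' : R -> 'M[R]_(m, n)) (G G' : R -> 'M[R]_(n, p)) :
  is_mxderive F F' -> is_mxderive G G' ->
  is_mxderive (fun t => F t *m G t) (fun t => F' t *m G t + F t *m G' t).
Proof.
move=> dF dG t i j; rewrite !mxE -big_split /=.
under eq_fun do rewrite mxE.
apply: is_derive_sumf => k.
exact: is_deriveMf (dF t i k) (dG t k j).
Qed.

Lemma is_mxderive_mull m n p (M : 'M[R]_(m, n)) (G G' : R -> 'M[R]_(n, p)) :
  is_mxderive G G' -> is_mxderive (fun t => M *m G t) (fun t => M *m G' t).
Proof.
move=> dG; apply: is_mxderive_eq (is_mxderiveM (is_mxderive_cst M) dG) _ => t.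
by rewrite mul0mx add0r.
Qed.

Lemma is_mxderive_mulr m n p (G G' : R -> 'M[R]_(m, n)) (M : 'M[R]_(n, p)) :
  is_mxderive G G' -> is_mxderive (fun t => G t *m M) (fun t => G' t *m M).
Proof.
move=> dG; apply: is_mxderive_eq (is_mxderiveM dG (is_mxderive_cst M)) _ => t.
by rewrite mulmx0 addr0.
Qed.

Lemma is_mxderiveD m n (F F' G G' : R -> 'M[R]_(m, n)) :
  is_mxderive F F' -> is_mxderive G G' ->
  is_mxderive (fun t => F t + G t) (fun t => F' t + G' t).
Proof.
move=> dF dG t i j; rewrite mxE; under eq_fun do rewrite mxE.
exact: is_deriveD.
Qed.

Lemma is_mxderive_tr m n (F F' : R -> 'M[R]_(m, n)) :
  is_mxderive F F' -> is_mxderive (fun t => (F t)^T) (fun t => (F' t)^T).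
Proof.
move=> dF t i j; rewrite mxE; under eq_fun do rewrite mxE; exact: dF.
Qed.

Lemma is_derive_mxtrace n (F F' : R -> 'M[R]_n) (t : R) :
  is_mxderive F F' -> is_derive t 1 (fun t => \tr (F t)) (\tr (F' t)).
Proof.
move=> dF; exact: (is_derive_sumf (h := fun i t => F t i i) (fun i => dF t i i)).
Qed.

End MatrixCalculus.

(** * The gain along a geodesic *)

Section GeodesicGain.
Variables (R : realType) (n : nat).
Variables (P S Q0 : 'M[R]_n) (kappa sigma : R).
Hypotheses (oP : orthoproj P) (oQ0 : orthoproj Q0).
Hypotheses (symS : S^T = S) (PS : P *m S = S).
(* This encodes 0 <= S <= sigma. *)
Hypothesis S_bound : forall m (N : 'M[R]_(m, n)),
  sqF (N *m S - (sigma / 2) *: N) <= (sigma / 2) ^+ 2 * sqF N.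
Hypotheses (kappa0 : 0 < kappa) (sigma0 : 0 < sigma).
Hypothesis ks1 : kappa * sigma <= 1.

Let P' := 1%:M - P.
Let oP' : orthoproj P'. Proof. exact: orthoprojC. Qed.
Let SP : S *m P = S.
Proof. by rewrite -{1}symS -{1}oP.1 -trmx_mul PS. Qed.
Let PP' : P *m P' = 0. Proof. by rewrite mulmxBr mulmx1 oP.2 subrr. Qed.
Let P'P : P' *m P = 0. Proof. by rewrite mulmxBl mul1mx oP.2 subrr. Qed.

(** [J] is the skew generator of the geodesic. In blocks relative to [P], [K] is its part inside the
    range of [P], [- L] and [L^T] are its off-diagonal parts, and the block inside the range of [P']
    vanishes because [P' S = 0]. *)
Let J := kappa *: (S *m Q0 - Q0 *m S).
Let L := kappa *: (P' *m Q0 *m S).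
Let K := kappa *: (S *m Q0 *m P - P *m Q0 *m S).
Let q := \tr (P' *m Q0 *m P *m Q0).
Let x := kappa * sigma.

Let JE : J = K - L + L^T.
Proof.
rewrite /J /K /L trmxZ !trmx_mul symS oQ0.1 oP'.1 -scalerBr -scalerDr.
congr (_ *: _); rewrite /P' !(mulmxBl, mulmxBr, mulmx1, mul1mx) !mulmxA.
by apply/matrixP => i j; rewrite !mxE; ring.
Qed.

Let P'L : P' *m L = L.
Proof. by rewrite -scalemxAr !mulmxA oP'.2. Qed.
Let LP : L *m P = L.
Proof. by rewrite -scalemxAl -mulmxA SP. Qed.
Let PL : P *m L = 0.
Proof. by rewrite -P'L mulmxA PP' mul0mx. Qed.
Let LP' : L *m P' = 0.
Proof. by rewrite -LP -mulmxA PP' mulmx0. Qed.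
Let LL : L *m L = 0.
Proof. by rewrite -{1}LP -mulmxA PL mulmx0. Qed.
Let P'LT : P' *m L^T = 0.
Proof. by rewrite -[P']oP'.1 -trmx_mul LP' trmx0. Qed.
Let LTP : L^T *m P = 0.
Proof. by rewrite -[P]oP.1 -trmx_mul PL trmx0. Qed.
Let PLT : P *m L^T = L^T.
Proof. by rewrite -[X in X *m _]oP.1 -trmx_mul LP. Qed.
Let PK : P *m K = K.
Proof. by rewrite -scalemxAr mulmxBr !mulmxA PS oP.2. Qed.
Let KP : K *m P = K.
Proof. by rewrite -scalemxAl mulmxBl -!mulmxA SP oP.2 !mulmxA. Qed.
Let P'K : P' *m K = 0.
Proof. by rewrite -PK mulmxA P'P mul0mx. Qed.
Let KL : K *m L = 0.
Proof. by rewrite -KP -mulmxA PL mulmx0. Qed.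
Let KT : K^T = - K.
Proof.
by rewrite /K trmxZ linearB /= !trmx_mul symS oQ0.1 oP.1 !mulmxA -scalerN opprB.
Qed.

(** The shift in [S_bound] is undone: both [S - sigma / 2] and [sigma / 2] have norm at most
    [sigma / 2]. *)
Let sqF_S m (N : 'M[R]_(m, n)) : sqF (N *m S) <= sigma ^+ 2 * sqF N.
Proof.
have := S_bound N.
have := sqFB_le (N *m S - (sigma / 2) *: N) (- ((sigma / 2) *: N)).
by rewrite opprK subrK -scaleNr sqFZ; lra.
Qed.

Let qE : q = sqF (P' *m Q0 *m P).
Proof.
rewrite (sqF_mulproj _ oP) trmx_mul oQ0.1 oP'.1 !mulmxA.
by rewrite [RHS]mxtrace_mulC !mulmxA oP'.2.
Qed.

Let sqF_L : sqF L <= x ^+ 2 * q.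
Proof.
rewrite qE.
have -> : L = kappa *: (P' *m Q0 *m P *m S) by rewrite -(mulmxA _ P) PS.
by rewrite sqFZ /x exprMn -(mulrA (kappa ^+ 2)) ler_pM2l ?exprn_gt0.
Qed.

Let q0 : 0 <= q.
Proof. by rewrite qE sqF_ge0. Qed.

(* Shifting S by sigma/2 and P Q0 P by 1/2 leaves their commutator K unchanged
   and halves both norms. *)
Let sqF_LK : sqF (L *m K) <= x ^+ 2 / 4 * sqF L.
Proof.
pose A := L *m S - (sigma / 2) *: L.
pose B := L *m (P *m Q0 *m P) - 2^-1 *: L.
have -> : L *m K = kappa *: ((A *m (P *m Q0 *m P) - 2^-1 *: A)
    - (B *m S - (sigma / 2) *: B)).
  rewrite -scalemxAr; congr (_ *: _); rewrite /A /B.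
  rewrite !(mulmxBl, mulmxBr) -!scalemxAl !mulmxA -!(mulmxA _ P S) PS.
  rewrite -!(mulmxA _ S P) SP.
  by apply/matrixP => i j; rewrite !mxE; ring.
rewrite sqFZ /x exprMn -!(mulrA (kappa ^+ 2)) ler_pM2l ?exprn_gt0//.
apply: le_trans (sqFB_le _ _) _.
have := sqF_compression_half A oP oQ0; have := S_bound B.
have := S_bound L; have := sqF_compression_half L oP oQ0.
rewrite -/A -/B => h1 h2 h3 h4.
have h5 : (sigma / 2) ^+ 2 * sqF B <= (sigma / 2) ^+ 2 * (4^-1 * sqF L).
  by apply: ler_wpM2l => //; exact: sqr_ge0.
lra.
Qed.

(** The generator stays frozen at [Q0]: the path is the geodesic leaving [Q0] in the gradient
    direction, not the gradient flow. *)
Variable Q : R -> 'M[R]_n.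
Hypothesis oQ : forall t, orthoproj (Q t).
Hypothesis Q0E : Q 0 = Q0.
Hypothesis dQ : is_mxderive Q (fun t => J *m Q t - Q t *m J).

Let y t := \tr (P' *m Q t *m P *m Q t).

Let yE t : y t = sqF (P' *m Q t *m P).
Proof.
rewrite (sqF_mulproj _ oP) trmx_mul (oQ t).1 oP'.1 !mulmxA.
by rewrite [RHS]mxtrace_mulC !mulmxA oP'.2.
Qed.

(** A matrix confined to the block from the range of [P] to that of [P'] sees only the same block of
    [Q t]. *)
Let tr_cross (X : 'M[R]_n) t : P' *m X = X -> X *m P = X ->
  \tr (X *m Q t) = \tr (X *m (P' *m Q t *m P)^T).
Proof.
move=> P'X XP; rewrite !trmx_mul (oQ t).1 oP.1 oP'.1 !mulmxA XP.
by rewrite [RHS]mxtrace_mulC !mulmxA P'X.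
Qed.

(** The derivative of [y], arranged so that [L] is multiplied by [1 - 2 P Q P], which is a
    contraction by [sqF_reflection]. *)
Let y' t := 2 * \tr ((L - 2 *: (L *m (P *m Q t *m P))) *m (P' *m Q t *m P)^T).

Let dy (t : R) : is_derive t 1 y (y' t).
Proof.
have dy0 := is_derive_mxtrace t (is_mxderiveM
  (is_mxderive_mulr P (is_mxderive_mull P' dQ)) dQ).
apply: is_derive_eq dy0 _.
have [sQ iQ] := oQ t.
set D := J *m Q t - Q t *m J.
have JT : J^T = - J.
  by rewrite /J trmxZ linearB /= !trmx_mul symS oQ0.1 -scalerN opprB.
have DT : D^T = D.
  by rewrite /D linearB /= !trmx_mul JT sQ mulmxN mulNmx opprK addrC.
(* As [D] is symmetric, the two terms of the product rule are transposes of each other up to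
   cyclicity. *)
have -> : \tr (P' *m D *m P *m Q t + P' *m Q t *m P *m D) =
    2 * \tr (P' *m D *m P *m Q t).
  rewrite mxtraceD -[\tr (P' *m Q t *m P *m D)]mxtrace_tr !trmx_mul.
  rewrite DT sQ oP.1 oP'.1 !mulmxA [X in _ + X]mxtrace_mulC !mulmxA.
  by ring.
rewrite /y'; congr (2 * _).
have P'J : P' *m J = - L by rewrite JE mulmxDr mulmxBr P'K P'L P'LT sub0r addr0.
have JP : J *m P = K - L by rewrite JE mulmxDl mulmxBl KP LP LTP addr0.
rewrite -tr_cross; last 2 first.
- by rewrite mulmxBr P'L -(scalemxAr 2) (mulmxA P' L) P'L.
- by rewrite mulmxBl LP -(scalemxAl 2) -!mulmxA oP.2.
have -> : P' *m D *m P *m Q t =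
    - (L *m Q t *m P *m Q t) - P' *m Q t *m K *m Q t + P' *m Q t *m L *m Q t.
  have -> : P' *m D *m P *m Q t =
      P' *m J *m Q t *m P *m Q t - P' *m Q t *m (J *m P) *m Q t.
    by rewrite /D (mulmxBr P') !mulmxBl !mulmxA.
  by rewrite P'J JP !mulNmx (mulmxBr (P' *m Q t)) (mulmxBl _ _ (Q t)) opprB addrA
    addrAC.
(* Skewness of [K] makes this trace equal to its own opposite. *)
have trK : \tr (P' *m Q t *m K *m Q t) = 0.
  have : \tr (P' *m Q t *m K *m Q t) = - \tr (P' *m Q t *m K *m Q t).
    rewrite -[LHS]mxtrace_tr !trmx_mul KT sQ oP'.1 mulNmx !mulmxN linearN /=.
    by rewrite !mulmxA [in LHS]mxtrace_mulC !mulmxA.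
  lra.
have trL : \tr (P' *m Q t *m L *m Q t) = \tr (L *m Q t) - \tr (L *m Q t *m P *m Q t).
  rewrite -mulmxA mxtrace_mulC !mulmxA /P' mulmxBr mulmx1 mulmxBl linearB /=.
  by rewrite -(mulmxA _ (Q t) (Q t)) iQ.
rewrite mxtraceD mxtraceB mxtraceN trK trL mulmxBl mxtraceB -(scalemxAl 2) mxtraceZ.
rewrite !mulmxA LP; ring.
Qed.

(** AM-GM with weight [1 + t] puts [y'] in the form required by [sqr_growth]; [kappa * sigma <= 1]
    enters to give [sqF L <= q]. *)
Let y_bound t : 0 <= t <= 1 -> y t <= (1 + t) ^+ 2 * q.
Proof.
move: t; apply: (sqr_growth dy) => [t /andP[t0 t1]|]; last by rewrite /y Q0E.
have h0 : 0 < 1 + t by lra.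
have h1 : 0 < (1 + t)^-1 by rewrite invr_gt0.
have := mxtrace_AMGM (L - 2 *: (L *m (P *m Q t *m P))) (P' *m Q t *m P) h0.
rewrite -/(y' t) -yE => /le_trans; apply.
rewrite addrC lerD2l ler_pM2l//.
apply: le_trans (sqF_reflection _ oP (oQ t)) _; apply: le_trans sqF_L _.
rewrite ler_piMl// expr_le1// /x mulr_ge0//; exact: ltW.
Qed.

Lemma geodesic_gain :
  \tr (P *m Q 0) + 2 * kappa * \tr (P' *m Q 0 *m S *m Q 0)
    - 2 * (kappa * sigma) ^+ 2 * \tr (P' *m Q 0 *m P *m Q 0)
  <= \tr (P *m Q 1).
Proof.
pose f1 t := 2 * \tr (L *m Q t).
pose f2 t := 2 * \tr (L *m (J *m Q t - Q t *m J)).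
(* The commutator of [P] and [J] is [L + L^T]: the block [K] cancels, and symmetry of [Q t] merges
   the two remaining traces. *)
have df (t : R) : is_derive t 1 (fun t => \tr (P *m Q t)) (f1 t).
  apply: is_derive_eq (is_derive_mxtrace t (is_mxderive_mull P dQ)) _.
  rewrite mulmxBr linearB /= JE !mulmxA.
  rewrite [X in _ - X]mxtrace_mulC mulmxA !(mulmxDl, mulmxDr, mulmxBl, mulmxBr).
  rewrite !mulNmx !mulmxN PL PK PLT KP LP LTP oppr0 !mul0mx.
  rewrite -linearB /= /f1.
  have -> : \tr (L *m Q t) = \tr (L^T *m Q t).
    by rewrite -mxtrace_tr trmx_mul (oQ t).1 mxtrace_mulC.
  have -> : 2 * \tr (L^T *m Q t) = \tr (L *m Q t) + \tr (L^T *m Q t).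
    rewrite -[in X in X + _]mxtrace_tr trmx_mul (oQ t).1 mxtrace_mulC; ring.
  by rewrite -mxtraceD; congr (\tr _); apply/matrixP => i j; rewrite !mxE; ring.
have df1 (t : R) : is_derive t 1 f1 (f2 t).
  exact: is_deriveMlf (is_derive_mxtrace t (is_mxderive_mull L dQ)).
have f2_ge t : 0 <= t <= 1 -> - (4 * x ^+ 2 * q) <= f2 t.
  move=> tI; have [sQ iQ] := oQ t.
  (* The first norm is dropped, the second is at most [sqF L <= x ^+ 2 * q], and the cross term is
     at least [- x ^+ 2 * q]; doubling the sum yields the constant 4. *)
  have -> : f2 t = 2 * (sqF (L^T *m Q t) - sqF (L *m Q t)
       + \tr (L *m K *m (P' *m Q t *m P)^T)).
    rewrite /f2; congr (2 * _).
    rewrite -tr_cross; last 2 first.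
    - by rewrite mulmxA P'L.
    - by rewrite -mulmxA KP.
    have LJ : L *m J = L *m K + L *m L^T.
      by rewrite JE (mulmxDr L) (mulmxBr L) LL subr0.
    have JL : J *m L = L^T *m L by rewrite JE mulmxDl mulmxBl KL LL subrr add0r.
    have -> : \tr (L *m (J *m Q t - Q t *m J)) =
        \tr (L *m J *m Q t) - \tr (J *m L *m Q t).
      rewrite (mulmxBr L) linearB /= !(mulmxA L) -(mulmxA J L).
      by rewrite [\tr (J *m _)]mxtrace_mulC.
    rewrite LJ JL mulmxDl mxtraceD !(sqF_mulproj _ (oQ t)) trmxK.
    rewrite [\tr (L^T *m Q t *m L)]mxtrace_mulC [\tr (L *m Q t *m L^T)]mxtrace_mulC.
    by rewrite (mulmxA L L^T) (mulmxA L^T L); ring.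
  have hQ : sqF (P' *m Q t *m P) <= 4 * q.
    rewrite -yE; apply: le_trans (y_bound tI) _; apply: ler_wpM2r => //.
    by move: tI => /andP[? ?]; rewrite expr2; nra.
  have x2 : 0 < x ^+ 2 by rewrite exprn_gt0// mulr_gt0.
  (* This weight balances AM-GM: by [sqF_LK] and [y <= 4 q], each of its two terms is at most
     [x ^+ 2 * q]. *)
  have a0 : 0 < 4 / x ^+ 2 by rewrite divr_gt0.
  have := mxtrace_AMGM (- (L *m K)) (P' *m Q t *m P) a0.
  rewrite mulNmx linearN /= -[- (L *m K)]scaleN1r sqFZ sqrrN expr1n mul1r.
  have h1 : 4 / x ^+ 2 * sqF (L *m K) <= sqF L.
    apply: le_trans (_ : 4 / x ^+ 2 * (x ^+ 2 / 4 * sqF L) <= _).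
      by rewrite ler_pM2l.
    rewrite mulrA (_ : 4 / x ^+ 2 * (x ^+ 2 / 4) = 1) ?mul1r//.
    by field; rewrite !mulf_neq0// gt_eqF.
  have h2 : sqF (P' *m Q t *m P) / (4 / x ^+ 2) <= x ^+ 2 * q.
    rewrite ler_pdivrMr// (_ : x ^+ 2 * q * (4 / x ^+ 2) = 4 * q)//.
    by field; rewrite gt_eqF// mulr_gt0.
  have := sqF_ge0 (L^T *m Q t); have := sqF_mulproj_le L (oQ t).
  have := sqF_L; set a := \tr _; set b := sqF (L *m Q t).
  set c := sqF (L^T *m Q t).
  lra.
have := second_order_lower_bound df df1 f2_ge.
apply: le_trans; rewrite /f1 Q0E -/q -/x -scalemxAl mxtraceZ.
by rewrite le_eqVlt; apply/orP; left; apply/eqP; field.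
Qed.

End GeodesicGain.

(** * The exponential map as a path of projectors *)

Section Geodesic.
Variable R : realType.

Lemma is_derive_mulr (a t : R) : is_derive t 1 (fun s => s * a) a.
Proof.
apply: is_derive_eq (is_deriveMf (is_derive_id t 1) (is_derive_cst a t 1)) _.
by rewrite mul1r mulr0 addr0.
Qed.

Lemma is_mxderive_diag d (h h' : R -> 'rV[R]_d) :
  is_mxderive h h' -> is_mxderive (fun t => diag_mx (h t)) (fun t => diag_mx (h' t)).
Proof.
move=> dh t i j; rewrite mxE; under eq_fun do rewrite mxE.
case: eqP => _; rewrite ?mulr1n ?mulr0n; last exact: is_derive_cst.
exact: dh.
Qed.

Lemma is_mxderive_cos d (s : 'rV[R]_d) :
  is_mxderive (fun t => diag_mx (map_mx (fun a => cos (t * a)) s))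
    (fun t => - (diag_mx s *m diag_mx (map_mx (fun a => sin (t * a)) s))).
Proof.
have dh : is_mxderive (fun t => map_mx (fun a => cos (t * a)) s)
    (fun t => - map_mx (fun a => a * sin (t * a)) s).
  move=> t i j; rewrite !mxE; under eq_fun do rewrite mxE.
  apply: is_derive_eq (is_derive1_comp (is_derive_cos _)
    (is_derive_mulr (s i j) t)) _.
  by rewrite mulNr mulrC.
apply: is_mxderive_eq (is_mxderive_diag dh) _ => t.
rewrite mulmx_diag -linearN /=; congr diag_mx.
by apply/matrixP => i j; rewrite !mxE !ord1.
Qed.

Lemma is_mxderive_sin d (s : 'rV[R]_d) :
  is_mxderive (fun t => diag_mx (map_mx (fun a => sin (t * a)) s))
    (fun t => diag_mx s *m diag_mx (map_mx (fun a => cos (t * a)) s)).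
Proof.
have dh : is_mxderive (fun t => map_mx (fun a => sin (t * a)) s)
    (fun t => map_mx (fun a => a * cos (t * a)) s).
  move=> t i j; rewrite !mxE; under eq_fun do rewrite mxE.
  apply: is_derive_eq (is_derive1_comp (is_derive_sin _)
    (is_derive_mulr (s i j) t)) _.
  by rewrite mulrC.
apply: is_mxderive_eq (is_mxderive_diag dh) _ => t.
rewrite mulmx_diag; congr diag_mx.
by apply/matrixP => i j; rewrite !mxE !ord1.
Qed.

(** [G^T V = 0] makes a column of [G^T Q1] vanish only where the singular value is nonzero; at the
    other columns the factor [sin 0 = 0] takes over. *)
Lemma mulmx_diag_eq0 n d (A : 'M[R]_(n, d)) (s : 'rV[R]_d) (f : R -> R) :
  f 0 = 0 -> A *m diag_mx s = 0 -> A *m diag_mx (map_mx f s) = 0.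
Proof.
move=> f0 /matrixP As; apply/matrixP => i j; have := As i j.
rewrite !mul_mx_diag !mxE => /eqP; rewrite mulf_eq0 => /orP[/eqP ->|/eqP ->].
  by rewrite mul0r.
by rewrite f0 mulr0.
Qed.

(** The frame [F t] obtained by scaling the angles by [t] stays orthonormal and solves [F' = J F]
    with [J] skew; hence [Q = F F^T] solves the commutator equation. *)
Lemma Exp_path n d (X Y : Gr R n d) (G V : 'M[R]_(n, d)) : is_Exp X G V Y ->
  exists Q : R -> 'M[R]_n,
  [/\ forall t, orthoproj (Q t), Q 0 = proj X, Q 1 = proj Y &
      is_mxderive Q (fun t => (V *m G^T - G *m V^T) *m Q t
                              - Q t *m (V *m G^T - G *m V^T))].
Proof.
move=> [[GG cG] GV [Q1 [s [Q2 [[QQ1 QQ2 _ VE] valY]]]]].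
have QQ2' : Q2 *m Q2^T = 1%:M by exact: mulmx1C.
have GQs : G^T *m Q1 *m diag_mx s = 0.
  have : G^T *m V *m Q2 = 0 by rewrite GV mul0mx.
  by rewrite VE !mulmxA -(mulmxA _ Q2^T) QQ2 mulmx1.
pose C t := diag_mx (map_mx (fun a => cos (t * a)) s).
pose Z t := diag_mx (map_mx (fun a => sin (t * a)) s).
have GQZ t : G^T *m Q1 *m Z t = 0.
  by apply: (mulmx_diag_eq0 (f := fun a => sin (t * a))) => //; rewrite mulr0 sin0.
have sQG : diag_mx s *m Q1^T *m G = 0.
  have := congr1 trmx GQs.
  by rewrite trmx0 !trmx_mul trmxK tr_diag_mx !mulmxA.
pose F t := G *m Q2 *m C t *m Q2^T + Q1 *m Z t *m Q2^T.
pose J := V *m G^T - G *m V^T.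
have GF t : G^T *m F t = Q2 *m C t *m Q2^T.
  by rewrite /F mulmxDr !mulmxA GG mul1mx GQZ mul0mx addr0.
have ZQG t : Z t *m Q1^T *m G = 0.
  have := congr1 trmx (GQZ t).
  by rewrite trmx0 !trmx_mul trmxK tr_diag_mx !mulmxA.
have CC t : C t *m C t + Z t *m Z t = 1%:M.
  rewrite !mulmx_diag -raddfD /=; apply/matrixP => i j; rewrite !mxE.
  by rewrite -!expr2 cos2Dsin2.
have FF t : (F t)^T *m F t = 1%:M.
  have -> : (F t)^T = Q2 *m C t *m (Q2^T *m G^T) + Q2 *m Z t *m Q1^T.
    have trD (A B : 'M[R]_(n, d)) : (A + B)^T = A^T + B^T by rewrite linearD.
    by rewrite trD !trmx_mul trmxK !tr_diag_mx !mulmxA.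
  rewrite mulmxDl -!(mulmxA (Q2 *m C t)) -(mulmxA Q2^T) GF.
  have -> : Q2 *m Z t *m Q1^T *m F t = Q2 *m (Z t *m Z t) *m Q2^T.
    have e : Z t *m Q1^T *m F t = Z t *m Z t *m Q2^T.
      rewrite /F mulmxDr !mulmxA ZQG !mul0mx add0r.
      by rewrite -(mulmxA _ Q1^T) QQ1 mulmx1.
    by rewrite -(mulmxA Q2 (Z t)) -(mulmxA Q2) e !mulmxA.
  rewrite !mulmxA -(mulmxA _ Q2^T Q2) QQ2 mulmx1 -mulmxDl -!(mulmxA Q2) -mulmxDr.
  by rewrite CC mulmx1 QQ2'.
have dF : is_mxderive F (fun t => J *m F t).
  apply: is_mxderive_eq (is_mxderiveD
    (is_mxderive_mulr Q2^T (is_mxderive_mull (G *m Q2) (is_mxderive_cos s)))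
    (is_mxderive_mulr Q2^T (is_mxderive_mull Q1 (is_mxderive_sin s)))) _ => t.
  rewrite -/(C t) -/(Z t) /J mulmxBl -(mulmxA V) GF.
  have -> : G *m V^T *m F t = G *m Q2 *m (diag_mx s *m Z t) *m Q2^T.
    rewrite VE !trmx_mul trmxK tr_diag_mx /F !mulmxDr !mulmxA.
    rewrite -(mulmxA (G *m Q2)) -(mulmxA (G *m Q2) _ G) sQG mulmx0 !mul0mx add0r.
    by rewrite -(mulmxA (G *m Q2)) -!mulmxA (mulmxA Q1^T) QQ1 mul1mx.
  rewrite VE !mulmxA -(mulmxA _ Q2^T Q2) QQ2 mulmx1 addrC.
  by rewrite mulmxN mulNmx !mulmxA.
have JT : J^T = - J by rewrite /J linearB /= !trmx_mul !trmxK opprB.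
exists (fun t => F t *m (F t)^T); split.
- by move=> t; exact: orthoproj_orth.
- have -> : F 0 = G.
    have C0 : C 0 = 1%:M.
      by apply/matrixP => i j; rewrite !mxE mul0r cos0.
    have Z0 : Z 0 = 0.
      by apply/matrixP => i j; rewrite !mxE mul0r sin0 mul0rn.
    by rewrite /F C0 Z0 mulmx1 mulmx0 mul0mx addr0 -mulmxA QQ2' mulmx1.
  by rewrite (@projE _ _ _ X G).
- rewrite (@projE _ _ _ Y (F 1))//; split => //; rewrite valY /F /C /Z.
  have one (f : R -> R) : map_mx (fun a => f (1 * a)) s = map_mx f s.
    by apply/matrixP => i j; rewrite !mxE mul1r.
  by rewrite !one.
- apply: is_mxderive_eq (is_mxderiveM dF (is_mxderive_tr dF)) _ => t.
  by rewrite trmx_mul JT !mulmxN -!mulmxA.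
Qed.

End Geodesic.

(** * Contraction of the gradient step *)

Section Grassmannian.
Variable R : realType.

Lemma orthoproj_proj n d (U : Gr R n d) : orthoproj (proj U).
Proof.
have [M HM] := ortho_rep_exists U; rewrite (projE HM).
by case: HM => MM _; exact: orthoproj_orth.
Qed.

Lemma mxtrace_proj n d (U : Gr R n d) : \tr (proj U) = d%:R.
Proof.
have [M HM] := ortho_rep_exists U; rewrite (projE HM).
by case: HM => MM _; rewrite mxtrace_mulC MM mxtrace1.
Qed.

Lemma mxrank_proj_le n d (U : Gr R n d) : (\rank (proj U) <= d)%N.
Proof.
have [M HM] := ortho_rep_exists U; rewrite (projE HM).
by apply: leq_trans (mxrankM_maxl _ _) _; exact: rank_leq_col.
Qed.

Lemma proj_id n d (U : Gr R n d) (v : 'cV[R]_n) : v \in val U -> proj U *m v = v.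
Proof.
have [M HM] := ortho_rep_exists U; rewrite (projE HM).
by case: HM => MM <- /colspanP[a ->]; rewrite -mulmxA (mulmxA M^T) MM mul1mx.
Qed.

Lemma sqr_chordal n d (U V : Gr R n d) :
  chordal U V ^+ 2 = \tr (proj_perp U *m proj V).
Proof.
rewrite sqr_sqrtr// mxtrace_projmul ?sqF_ge0//; last exact: orthoproj_proj.
exact/orthoprojC/orthoproj_proj.
Qed.

Lemma sqr_chordalE n d (U V : Gr R n d) :
  chordal U V ^+ 2 = d%:R - \tr (proj U *m proj V).
Proof. by rewrite sqr_chordal mulmxBl mul1mx linearB /= mxtrace_proj. Qed.

Lemma chordalC n d (U V : Gr R n d) : chordal U V = chordal V U.
Proof.
apply/eqP; rewrite -(@eqrXn2 _ 2) ?sqrtr_ge0//.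
by rewrite !sqr_chordalE mxtrace_mulC.
Qed.

(** The squared Frobenius distance of the two projectors is twice the squared chordal distance. *)
Lemma chordal_eq0 n d (U V : Gr R n d) : chordal U V = 0 -> proj U = proj V.
Proof.
have [sU iU] := orthoproj_proj U; have [sV iV] := orthoproj_proj V.
move=> c0; apply/eqP; rewrite -subr_eq0; apply/eqP/sqF_eq0.
have := sqr_chordalE U V; rewrite c0 expr0n /= => h.
by rewrite sqFB /sqF sU sV iU iV !mxtrace_proj; lra.
Qed.

(** A positive [d]-th singular value forces [W] to have rank [d], so its columns span [U] and
    [proj U = Y *m W^T] for some [Y]. The spectral bound is then applied to [N *m Y]. *)
Lemma sqF_mul_ge_singval_proj n d T (U : Gr R n d) (W : 'M[R]_(n, T)) (a : R) :
  (0 < d <= T)%N -> proj U *m W = W -> 0 < a -> a <= singval d W ->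
  forall p (N : 'M[R]_(p, n)), a ^+ 2 * sqF (N *m proj U) <= sqF (N *m W).
Proof.
move=> dT PW a0 aW p N.
have rkW : (\rank W <= d)%N.
  by rewrite -PW; apply: leq_trans (mxrankM_maxl _ _) _; exact: mxrank_proj_le.
have [rkWE hW] := sqF_mul_ge_singval dT rkW a0 aW.
have WP : W^T = W^T *m proj U.
  by rewrite -[in LHS]PW trmx_mul (orthoproj_proj U).1.
have sub : (W^T <= proj U)%MS by rewrite WP submxMl.
have /submxP[Y PE] : (proj U <= W^T)%MS.
  by rewrite -(geq_leqif (mxrank_leqif_sup sub)) mxrank_tr rkWE mxrank_proj_le.
by have := hW _ (N *m Y); rewrite -(mulmxA N) -PE -(mulmxA N) PW.
Qed.

(** [geodesic_gain] with [kappa = 2 alpha] and [sigma = sbar ^+ 2] gains at least [4 b eta], and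
    [defect_ge] bounds [eta] below by [1 - r] times the squared error. *)
Lemma grad_step_contraction n d T (W : 'M[R]_(n, T)) (X Y U : Gr R n d)
    (alpha slow sbar r : R) :
  proj U *m W = W ->
  (forall p (N : 'M[R]_(p, T)), sqF (N *m W^T) <= sbar ^+ 2 * sqF N) ->
  (forall p (N : 'M[R]_(p, n)),
     slow ^+ 2 * sqF (N *m proj U) <= sqF (N *m W)) ->
  0 < slow <= sbar -> 0 < alpha < slow ^+ 2 / (2 * sbar ^+ 4) ->
  grad_step W alpha X Y -> chordal X U ^+ 2 <= r ->
  chordal Y U ^+ 2 <=
    (1 - 4 * (1 - r) * (alpha * slow ^+ 2 - 2 * alpha ^+ 2 * sbar ^+ 4))
      * chordal X U ^+ 2.
Proof.
move=> PW hup hlow /andP[slow0 les] /andP[al0 al1] [G hExp] hr.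
have sbar0 : 0 < sbar by apply: lt_le_trans les.
have oP := orthoproj_proj U; have oX := orthoproj_proj X.
have [Q [oQ Q0 Q1 dQ]] := Exp_path hExp.
pose S := W *m W^T; pose sigma := sbar ^+ 2; pose kappa := 2 * alpha.
have sigma0 : 0 < sigma by rewrite exprn_gt0.
have kappa0 : 0 < kappa by rewrite mulr_gt0.
have symS : S^T = S by rewrite trmx_mul trmxK.
have PS : proj U *m S = S by rewrite mulmxA PW.
have S_bound m (N : 'M[R]_(m, n)) :
    sqF (N *m S - (sigma / 2) *: N) <= (sigma / 2) ^+ 2 * sqF N.
  rewrite sqFB sqFZ trmxZ -scalemxAr mxtraceZ.
  have -> : \tr (N *m S *m N^T) = sqF (N *m W).
    by rewrite /sqF trmx_mul !mulmxA.
  by have := hup _ (N *m W); rewrite -mulmxA -/S -/sigma; lra.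
have alpha_bound : 2 * alpha * sbar ^+ 4 < slow ^+ 2.
  by move: al1; rewrite ltr_pdivlMr ?mulr_gt0 ?exprn_gt0//; lra.
(* The step size condition gives [2 alpha sbar^4 < slow^2 <= sbar^2]; division by [sbar^2]
   finishes. *)
have ks1 : kappa * sigma <= 1.
  have : slow ^+ 2 <= sigma by rewrite ler_pXn2r// ?nnegrE ltW.
  have -> : kappa * sigma = 2 * alpha * sbar ^+ 4 / sigma.
    by rewrite /kappa /sigma; field; rewrite gt_eqF.
  by rewrite ler_pdivrMr// mul1r; apply: le_trans; exact: ltW.
have dQ' : is_mxderive Q (fun t =>
    (kappa *: (S *m Q 0 - Q 0 *m S)) *m Q t
    - Q t *m (kappa *: (S *m Q 0 - Q 0 *m S))).
  (* The factor [-2] of the gradient produces [kappa]. Skew-symmetrizing [(1 - Q) S Q] cancels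
     [Q S Q] and leaves the commutator of [S] and [Q]. *)
  have -> // : kappa *: (S *m Q 0 - Q 0 *m S) =
      (- alpha *: grad_cost W X G) *m G^T - G *m (- alpha *: grad_cost W X G)^T.
  case: hExp => hG _ _.
  rewrite /grad_cost scalerA (_ : - alpha * -2 = kappa); last first.
    by rewrite /kappa; ring.
  have PE := projE hG.
  rewrite -scalemxAl trmxZ -scalemxAr -scalerBr; congr (_ *: _).
  rewrite -(mulmxA _ W) -/S 2!trmx_mul symS !mulmxA -(mulmxA _ G) -PE Q0.
  rewrite (orthoprojC oX).1 /proj_perp !(mulmxBl, mulmxBr, mulmx1, mul1mx).
  by rewrite opprB addrA subrK.
have gain := geodesic_gain oP (oQ 0) symS PS S_bound kappa0 sigma0 ks1 oQ erefl dQ'.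
rewrite Q0 Q1 in gain.
set eta := \tr ((1%:M - proj U) *m proj X *m proj U *m proj X) in gain.
have first : slow ^+ 2 * eta <= \tr ((1%:M - proj U) *m proj X *m S *m proj X).
  have NT : ((1%:M - proj U) *m proj X)^T = proj X *m (1%:M - proj U).
    by rewrite trmx_mul oX.1 (orthoprojC oP).1.
  have rot (M : 'M[R]_n) : \tr ((1%:M - proj U) *m proj X *m M
        *m (proj X *m (1%:M - proj U))) =
      \tr ((1%:M - proj U) *m proj X *m M *m proj X).
    by rewrite mulmxA mxtrace_mulC !mulmxA (orthoprojC oP).2.
  have e : sqF ((1%:M - proj U) *m proj X *m W) =
      \tr ((1%:M - proj U) *m proj X *m S *m proj X).
    by rewrite -rot -NT /sqF /S (trmx_mul _ W) !mulmxA.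
  by have := hlow _ ((1%:M - proj U) *m proj X); rewrite e (sqF_mulproj _ oP) NT rot.
have eX := sqr_chordal X U; have eXE := sqr_chordalE X U.
have eYE := sqr_chordalE Y U.
have defect := @defect_ge _ _ (proj U) (proj X) r oP oX.
rewrite -/(proj_perp X) -eX -/eta in defect.
have {defect} := defect hr.
move: gain; rewrite [\tr (proj U *m proj X)]mxtrace_mulC.
rewrite [\tr (proj U *m proj Y)]mxtrace_mulC => gain hdef.
set b := alpha * slow ^+ 2 - 2 * alpha ^+ 2 * sbar ^+ 4.
have b0 : 0 <= b.
  have -> : b = alpha * (slow ^+ 2 - 2 * alpha * sbar ^+ 4) by rewrite /b; ring.
  by rewrite mulr_ge0 ?subr_ge0 ?ltW.
have h1 : 4 * b * ((1 - r) * chordal X U ^+ 2) <= 4 * b * eta.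
  by apply: ler_wpM2l => //; rewrite mulr_ge0.
have h2 : 2 * kappa * (slow ^+ 2 * eta) <=
    2 * kappa * \tr ((1%:M - proj U) *m proj X *m S *m proj X).
  by apply: ler_wpM2l => //; rewrite mulr_ge0// ltW.
have h3 : 2 * kappa * (slow ^+ 2 * eta) - 2 * (kappa * sigma) ^+ 2 * eta =
   4 * b * eta.
  by rewrite /kappa /sigma /b; ring.
rewrite (_ : (1 - _) * _ = chordal X U ^+ 2
   - 4 * b * ((1 - r) * chordal X U ^+ 2)); last by ring.
lra.
Qed.

Lemma constant_proj n d (U : nat -> Gr R n d) :
  (forall t, (1 <= t)%N -> chordal (U t) (U t.+1) <= 0) ->
  forall t, (1 <= t)%N -> proj (U t) = proj (U 1%N).
Proof.
move=> h; elim=> [//|[//|t] IH _]; rewrite -IH//; apply/esym/chordal_eq0/eqP.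
by rewrite eq_le h// sqrtr_ge0.
Qed.

Lemma chordal_congr n d (U V V' : Gr R n d) :
  proj V = proj V' -> chordal U V = chordal U V'.
Proof. by move=> e; rewrite /chordal e. Qed.

End Grassmannian.

(** * Linear convergence for a static noiseless subspace *)

(* MathComp / MathComp-Analysis. Sequences indexed by the positive integers are functions on
   nat that are only constrained at positive indices. *)
Theorem corollary1 (R : realType) (n d : nat) (hd : (1 <= d)%N)
  (hdn : (d <= n)%N)
  (U : nat -> Gr R n d) (u : nat -> 'cV[R]_n)
  (t0 : nat) (ht0 : (d <= t0)%N)
  (T : nat) (hT : (d <= T <= t0 + 1)%N)
  (K : nat) (hK : (1 <= K)%N)
  (eps : R) (heps : 0 <= eps)
  (A1 : forall t : nat, (1 <= t)%N ->
     exists ubar e : 'cV[R]_n,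
       [/\ u t = ubar + e, ubar \in val (U t) & normF e <= eps])
  (c : R) (hc : 0 <= c)
  (A2 : forall t : nat, (1 <= t)%N -> chordal (U t) (U t.+1) <= c)
  (slow sbar : R) (hslow : 0 < slow) (hsbar : slow <= sbar)
  (A3 : forall t : nat, (T <= t)%N ->
     singval 1 (proj (U t) *m window u T t) <= sbar /\
     slow <= singval d (proj (U t) *m window u T t))
  (alpha : R) (halpha : 0 < alpha)
  (halpha' : alpha < slow ^+ 2 / (2 * sbar ^+ 4))
  (Uhat : nat -> Gr R n d)
  (rb : R) (hcrb : c <= rb) (hrb : rb < 1)
  (hinit : Gr_ball rb (U t0.+1) (Uhat t0))
  (rho : R)
  (hrho : rho = 1 - 4 * (1 - rb ^+ 2)
                      * (alpha * slow ^+ 2 - 2 * alpha ^+ 2 * sbar ^+ 4))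
  (hrho0 : 0 <= rho)
  (A4 : forall t : nat, (t0 <= t)%N -> (T <= t)%N ->
     gamma alpha sbar rb (noise_bound u T c eps t) <=
       (1 - rho) * rb ^+ 2
       + (1 - rho) * (c ^+ 2 - 2 * c * rb) / (1 - rho ^+ K))
  (hc0 : c = 0) (heps0 : eps = 0)
  (hrun : GREAT_output u T alpha K t0 Uhat) :
  forall t : nat, (t0 + 1 <= t)%N ->
    chordal (Uhat t) (U t) ^+ 2 <=
      rho ^+ (K * (t - t0)) * chordal (Uhat t0) (U t0) ^+ 2.
Proof.
have /andP[hdT hTt] := hT.
have t0gt0 : (0 < t0)%N by apply: leq_trans ht0.
(* All subspaces of positive index share one projector, and the chordal distance depends only on
   projectors, so every error can be measured against [V]. *)
pose V := U 1%N.
have UV t : (1 <= t)%N -> proj (U t) = proj V.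
  by apply: constant_proj => s hs; rewrite -hc0 A2.
have chV X t : (1 <= t)%N -> chordal X (U t) = chordal X V.
  by move=> ht; apply/chordal_congr/UV.
have uV t : (1 <= t)%N -> proj V *m u t = u t.
  move=> ht; have [ub [e [-> hub he]]] := A1 t ht.
  have /eqP : normF e = 0 by apply/eqP; rewrite eq_le sqrtr_ge0 andbT -heps0.
  by rewrite normF_eq0 => /eqP ->; rewrite addr0 -(UV _ ht) proj_id.
(* The column index [t - T + 1 + j] is positive even where the subtraction truncates. *)
have WV t : proj V *m window u T t = window u T t.
  apply/matrixP => i j; rewrite [RHS]mxE.
  have := uV (t - T + 1 + j)%N; rewrite addn1 addSn => /(_ isT) /colP /(_ i) <-.
  by rewrite !mxE; apply: eq_bigr => k _; rewrite !mxE addn1 addSn.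
have rb0 : 0 <= rb by rewrite (le_trans hc).
have rb1 : 0 <= 1 - rb ^+ 2 by rewrite subr_ge0 expr_le1// ltW.
have b0 : 0 <= alpha * slow ^+ 2 - 2 * alpha ^+ 2 * sbar ^+ 4.
  have -> : alpha * slow ^+ 2 - 2 * alpha ^+ 2 * sbar ^+ 4 =
    alpha * (slow ^+ 2 - alpha * (2 * sbar ^+ 4)) by ring.
  rewrite mulr_ge0 ?subr_ge0 ?ltW// -ltr_pdivlMr//.
  by rewrite mulr_gt0// exprn_gt0// (lt_le_trans hslow).
have rho1 : rho <= 1 by rewrite hrho gerBl !mulr_ge0.
have step t X Y : (t0 < t)%N -> grad_step (window u T t) alpha X Y ->
    chordal X V ^+ 2 <= rb ^+ 2 ->
    chordal Y V ^+ 2 <= rho * chordal X V ^+ 2.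
  move=> tt hstep hX; rewrite hrho.
  have Tt : (T <= t)%N by rewrite (leq_trans hTt)// addn1.
  have t1 : (1 <= t)%N by apply: leq_trans tt.
  have [] := A3 t Tt; rewrite UV// WV => h1 hlow.
  apply: (grad_step_contraction (WV t)) hstep hX.
  - by move=> p N; exact: sqF_mul_le_singval1.
  - by apply: sqF_mul_ge_singval_proj => //; rewrite hd.
  - by rewrite hslow.
  - by rewrite halpha.
(* The contraction applies only inside the ball of radius [rb]; since [rho <= 1], no inner iterate
   leaves it. *)
have iter t : (t0 < t)%N -> chordal (Uhat t.-1) V ^+ 2 <= rb ^+ 2 ->
    chordal (Uhat t) V ^+ 2 <= rho ^+ K * chordal (Uhat t.-1) V ^+ 2.
  move=> tt hX; have [X [X0 Xs ->]] := hrun t tt.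
  suff H k : (k <= K)%N ->
      chordal (X k) V ^+ 2 <= rho ^+ k * chordal (Uhat t.-1) V ^+ 2.
    exact: H.
  elim: k => [_|k IH kK]; first by rewrite X0 expr0 mul1r.
  have hk := IH (ltnW kK).
  apply: le_trans (step t _ _ tt (Xs k kK) _) _.
    apply: le_trans hk _; apply: le_trans hX.
    by rewrite ler_piMl ?sqr_ge0// exprn_ile1.
  by rewrite (exprS rho) -mulrA ler_wpM2l.
(* The initial ball is centred at [U t0.+1], which has the same projector as [V]. *)
have init : chordal (Uhat t0) V ^+ 2 <= rb ^+ 2.
  rewrite ler_pXn2r// ?nnegrE ?sqrtr_ge0//.
  by rewrite -(chV _ t0.+1)// chordalC.
have main k : chordal (Uhat (t0 + k)%N) V ^+ 2 <=
    rho ^+ (K * k) * chordal (Uhat t0) V ^+ 2.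
  elim: k => [|k IH]; first by rewrite muln0 expr0 mul1r addn0.
  rewrite addnS; apply: le_trans (iter _ _ _) _.
  - by rewrite ltnS leq_addr.
  - apply: le_trans IH _; apply: le_trans init.
    by rewrite ler_piMl ?sqr_ge0// exprn_ile1.
  - by rewrite mulnS (exprD rho) -mulrA ler_wpM2l// exprn_ge0.
move=> t ht; rewrite !chV ?(leq_trans _ ht) ?addn1//.
have := main (t - t0)%N; rewrite subnKC//.
by apply: leq_trans ht; rewrite leq_addr.
Qed.
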